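(* Let $w$ be a normal function with $b_w>-1$ and let $p>1$. Then every sequence $(z_n)_{n=1}^\infty$ in the unit disk $\mathbb{D}$ which is an interpolating sequence for $H^\infty$ is an interpolating sequence for the weighted Bergman space $L_a^p(w)$.
   Context: $\mathbb{D}$ is the open unit disk in $\mathbb{C}$ and $dA$ is area measure on $\mathbb{D}$. Normal functions: a measurable function $w:[0,1)\to(0,\infty)$, bounded above and bounded away from $0$ on each interval $[0,r]$ with $r<1$, is called normal if there exist real numbers $a,b$ and $r_0\in(0,1)$ such that, on $(r_0,1)$, the function $w(r)/(1-r)^a$ is increasing and tends to $\infty$ as $r\to1^-$, and the function $w(r)/(1-r)^b$ is decreasing and tends to $0$ as $r\to 1^-$. It is extended to $\mathbb{D}$ radially by $w(z)=w(|z|)$. The number $a_w$ is the infimum of all real $a$ for which there is $r_a\in(0,1)$ such that $w(r)/(1-r)^a$ increases to $\infty$ on $(r_a,1)$; the number $b_w$ is the supremum of all real $b$ for which there is $r_b\in(0,1)$ such that $w(r)/(1-r)^b$ decreases to $0$ on $(r_b,1)$. $L_a^p(w)$ is the space of analytic functions $f$ in $\mathbb{D}$ with $\|f\|_{p,w}^p=\int_{\mathbb{D}}|f|^p\,w\,dA<\infty$. A sequence $(z_n)$ in $\mathbb{D}$ is interpolating for $H^\infty$ (the bounded analytic functions in $\mathbb{D}$) if every bounded sequence of complex numbers is of the form $(f(z_n))$ with $f\in H^\infty$; by Carleson's theorem this is equivalent to $\inf_n\prod_{k\ne n}\left|\frac{z_k-z_n}{1-\overline{z}_kz_n}\right|>0$.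 A sequence $(z_n)$ in $\mathbb{D}$ is interpolating for $L_a^p(w)$ if for every $(a_n)\in\ell^p$ there exists $f\in L_a^p(w)$ with $f(z_n)\left(w(|z_n|)(1-|z_n|)^2\right)^{1/p}=a_n$ for all $n$. *)

(* Defs.v *)
From HB Require Import structures.
From mathcomp Require Import all_boot all_order all_algebra.
From mathcomp Require Import complex.
From mathcomp Require Import all_classical all_reals all_analysis.
From mathcomp Require Import measurable_realfun.
Import Order.TTheory GRing.Theory Num.Theory.
Import numFieldNormedType.Exports.
(* [normc z : R] is the modulus as a real number; the norm [`|z|] of [z : R[i]]
   lives in [R[i]] and is [(normc z)%:C]. *)
Import ComplexField.Normc.

Set Implicit Arguments.
Unset Strict Implicit.
Unset Printing Implicit Defensive.

Local Open Scope classical_set_scope.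
Local Open Scope complex_scope.
Local Open Scope ring_scope.

Definition disk (R : realType) : set R[i] := [set z | normc z < 1].

(* [R[i]^o] is C as a normed space over itself, so [derivable] is complex
   differentiability. Functions are total on C; only their values on the
   (open) disk are ever used. *)
Definition analytic_disk (R : realType) (f : R[i] -> R[i]) : Prop :=
  forall z, disk z -> derivable (f : R[i]^o -> R[i]^o) z 1.

(* Monotonicity below is non-strict. The strict reading gives the same normal
   functions and the same [b_index]: moving the exponent by any e > 0 (up for
   the increasing condition, down for the decreasing one) multiplies the
   positive quotient by a strictly monotone factor. *)
Definition quot_increases_to_infty (R : realType) (w : R -> R) (a r0 : R)
    : Prop :=
  {in `]r0, 1[ &, {homo (fun r => w r / (1 - r) `^ a) : s t / s <= t}} /\
  w r / (1 - r) `^ a @[r --> 1^'-] --> +oo.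

Definition quot_decreases_to_zero (R : realType) (w : R -> R) (b r0 : R)
    : Prop :=
  {in `]r0, 1[ &,
    {homo (fun r => w r / (1 - r) `^ b) : s t / s <= t >-> t <= s}} /\
  w r / (1 - r) `^ b @[r --> 1^'-] --> (0 : R).

(* [measurable_fun] over [R] itself would mean Borel measurable. *)
Definition lebesgue_measurable_fun (R : realType) (D : set R) (w : R -> R)
    : Prop :=
  measurable_fun
    (D : set (g_sigma_algebraType (completed_algebra_gen (@lebesgue_measure R))))
    w.

(* The weight is a function on [0, 1); values elsewhere are irrelevant. *)
Record normal_function (R : realType) (w : R -> R) : Prop := {
  nf_gt0 : forall r : R, 0 <= r < 1 -> 0 < w r ;
  nf_measurable : lebesgue_measurable_fun `[0, 1[ w ;
  nf_bounded : forall r : R, 0 <= r < 1 ->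
    exists m M : R, 0 < m /\ forall t : R, 0 <= t <= r -> m <= w t <= M ;
  nf_exponents : exists a b r0 : R, 0 < r0 < 1 /\
    quot_increases_to_infty w a r0 /\ quot_decreases_to_zero w b r0 }.

(* Taken in the extended reals so as not to depend on the junk value of [sup];
   it is finite when [w] is normal. *)
Definition b_index (R : realType) (w : R -> R) : \bar R :=
  ereal_sup [set b%:E | b in
    [set b : R | exists2 rb : R, 0 < rb < 1 & quot_decreases_to_zero w b rb]].

Definition Hinfty (R : realType) (f : R[i] -> R[i]) : Prop :=
  analytic_disk f /\ exists M : R, forall z, disk z -> normc (f z) <= M.

(* The library integral of a nonnegative function is the supremum of the
   integrals of the Borel simple functions below it. A nonnegative Lebesgue
   measurable function dominates a Borel function equal to it almost everywhere,
   so this is its Lebesgue integral even when [w] is not Borel. *)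
Definition bergman (R : realType) (p : R) (w : R -> R) (f : R[i] -> R[i])
    : Prop :=
  analytic_disk f /\
  (\int[@lebesgue_measure R \x @lebesgue_measure R]_
     (u in [set u : R * R | disk (u.1 +i* u.2)])
     (normc (f (u.1 +i* u.2)) `^ p * w (normc (u.1 +i* u.2)))%:E < +oo)%E.

Definition little_l (R : realType) (p : R) (c : nat -> R[i]) : Prop :=
  (\sum_(0 <= n <oo) (normc (c n) `^ p)%:E < +oo)%E.

Definition interpolating_Hinfty (R : realType) (z : nat -> R[i]) : Prop :=
  forall c : nat -> R[i], (exists M : R, forall n, normc (c n) <= M) ->
  exists2 f, Hinfty f & forall n, f (z n) = c n.

Definition interpolating_bergman (R : realType) (p : R) (w : R -> R)
    (z : nat -> R[i]) : Prop :=
  forall c : nat -> R[i], little_l p c ->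
  exists2 f, bergman p w f & forall n,
    f (z n) * ((w (normc (z n)) * (1 - normc (z n)) ^+ 2) `^ p^-1)%:C = c n.

(* Main.v *)
Require Import Defs.
From HB Require Import structures.
From mathcomp Require Import all_boot all_order all_algebra.
From mathcomp Require Import complex.
From mathcomp Require Import all_classical all_reals all_analysis.
From mathcomp Require Import measurable_realfun.
From mathcomp Require Import ring lra.
(** The interpolating function is explicit. Put
  om_n = (w(|z_n|) (1 - |z_n|)^2)^(1/p),
  k_n(u) = ((1 - |z_n|^2) / (1 - conj(z_n) u))^s with s a large integer,
and suppose that F_n are bounded analytic functions with F_n(z_m) = 1 if m = n,
F_n(z_m) = 0 otherwise, and sum_n |F_n| <= Q on the disk (P. Beurling's
functions). Then f = sum_n (c_n / om_n) k_n F_n takes the values c_n / om_n at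
the points z_n. At each point |f| is at most Q times the largest of the numbers
|c_n| |k_n| / om_n, hence |f|^p <= Q^p sum_n |c_n|^p |k_n|^p / om_n^p, and it is
enough that the integral of |k_n|^p w is at most a constant times om_n^p.

That estimate ([peak_weight], [integral_majorant]) uses normality as follows.
With t = (1 - r) / (1 - r'), w(r) / w(r') is at most C (t^A + t^b) for some
integer A and some b in (-1, 0) ([weight_compare]). The factor t^A is absorbed
by the decay of k_n. The factor t^b is a singularity along the unit circle,
integrable because b > -1: in a Cartesian slice the distance to the circle is
comparable to the distance to the end of the slice, provided that one slices
horizontally where |Im u| is small and vertically where |Re u| is small.

Beurling functions are produced for finitely many indices at a time
([beurling_functions]): the interpolation constant of (z_n) is finite, so there
are functions g_e of norm at most M taking the value e_k at z_k for every choice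
of signs e on a finite block of indices, and the value 0 at the other points.
The averages G_k of e_k g_e over all signs satisfy sum_k |G_k|^2 <= M^2 by
Bessel's inequality, and F_k = G_k^2. To use finite blocks only, cut the indices
into blocks on which sum |c_n|^p is at most S 4^(-p j); the factor 2^j that can
then be inserted in the j-th block turns the sum over the blocks into a maximum
as well, so no limit of Beurling functions is needed.

Finiteness of the interpolation constant ([bounded_interpolation]) is the open
mapping theorem for the evaluation map from H^oo onto l^oo. It is proved with a
gliding hump followed by successive approximation.

Apart from algebraic rules, the only fact needed about analytic functions is that the sum of a
series of analytic functions dominated by K 2^(-j) on each smaller disk is
analytic ([analytic_series]). Complex differentiability at every point is all
that is assumed, so this rests on Cauchy's estimate for f', which is derived
from Goursat's bisection argument on squares. *)

Import Order.TTheory GRing.Theory Num.Theory.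
Import numFieldNormedType.Exports.
Import ComplexField.Normc.

Set Implicit Arguments.
Unset Strict Implicit.
Unset Printing Implicit Defensive.

Local Open Scope classical_set_scope.
Local Open Scope complex_scope.
Local Open Scope ring_scope.

Local Notation Re := complex.Re.
Local Notation Im := complex.Im.

(** * Complex modulus and complex derivative *)

Section Normc.
Variable R : realType.
Implicit Types (x y z h : R[i]) (r : R).

Lemma normc_ge0 z : 0 <= normc z.
Proof. by case: z => a b; exact: sqrtr_ge0. Qed.

Lemma normr_normc z : `|z| = (normc z)%:C.
Proof. by rewrite normc_def; case: z. Qed.

Lemma normc_eq0 z : (normc z == 0) = (z == 0).
Proof.
by apply/eqP/eqP => [/eq0_normc//|->]; rewrite normc0.
Qed.

Lemma normc_gt0 z : (0 < normc z) = (z != 0).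
Proof. by rewrite lt_def normc_eq0 normc_ge0 andbT. Qed.

Lemma normcB x y : normc (x - y) = normc (y - x).
Proof. by rewrite -opprB normcN. Qed.

Lemma le_normcB x y : normc (x - y) <= normc x + normc y.
Proof. by apply: le_trans (le_normcD _ _) _; rewrite normcN. Qed.

Lemma le_normc_sub x y : normc x - normc y <= normc (x - y).
Proof. by have := le_normcD (x - y) y; rewrite subrK; lra. Qed.

Lemma normcR r : normc r%:C = `|r|.
Proof. by rewrite /= expr0n addr0 sqrtr_sqr. Qed.

Lemma normcX z n : normc (z ^+ n) = normc z ^+ n.
Proof. by elim: n => [|n IH]; rewrite ?expr0 ?normc1// !exprS normcM IH. Qed.

Lemma normc_sum (I : Type) (s : seq I) (P : pred I) (F : I -> R[i]) :
  normc (\sum_(i <- s | P i) F i) <= \sum_(i <- s | P i) normc (F i).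
Proof.
elim/big_rec2 : _ => [|i u v _ uv]; first by rewrite normc0.
by apply: le_trans (le_normcD _ _) _; rewrite lerD2l.
Qed.

Lemma le_Re z : `|Re z| <= normc z.
Proof.
case: z => a b /=; rewrite -sqrtr_sqr ler_wsqrtr//.
by rewrite lerDl sqr_ge0.
Qed.

Lemma le_Im z : `|Im z| <= normc z.
Proof.
case: z => a b /=; rewrite -sqrtr_sqr ler_wsqrtr//.
by rewrite lerDr sqr_ge0.
Qed.

Lemma normc_le_ReIm z : normc z <= `|Re z| + `|Im z|.
Proof.
case: z => a b.
have -> : a +i* b = a%:C + (b *i)%C :> R[i] by rewrite /real_complex_def; congr Complex => /=; ring.
apply: le_trans (le_normcD _ _) _; rewrite normcR /= expr0n add0r sqrtr_sqr.
by rewrite addr0 add0r.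
Qed.

End Normc.

Section Cdiff.
Variable R : realType.
Implicit Types (z h d : R[i]) (f g : R[i] -> R[i]).

(** Differentiability in epsilon-delta form, because the norm of [R[i]] is itself
complex valued, whereas the estimates below compare real numbers. *)
Definition cdiff f z d := forall e : R, 0 < e -> exists2 r : R, 0 < r &
  forall h, normc h < r -> normc (f (z + h) - f z - d * h) <= e * normc h.

Lemma derivable_cdiff f z : derivable (f : R[i]^o -> R[i]^o) z 1 ->
  exists d, cdiff f z d.
Proof.
move=> /cvg_ex[d df]; exists d => e e0.
have e0' : 0 < e%:C by rewrite ltcR.
move/cvgrPdist_le: df => /(_ _ e0') /nbhs_ballP[r /= r0 rH].
have rr : r = (Re r)%:C by rewrite RRe_real// gtr0_real.
exists (Re r) => [|h hr]; first by rewrite -ltcR -rr.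
have [->|h0] := eqVneq h 0.
  by rewrite addr0 subrr mulr0 subrr !normc0 mulr0.
have := rH h; rewrite /ball /= sub0r normrN normr_normc rr ltcR => /(_ hr h0).
rewrite normr_normc lecR /shift /=.
rewrite /GRing.scale /= mulr1 => H.
have -> : f (z + h) - f z - d * h = - (d - h^-1 * (f (h + z) - f z)) * h.
  by rewrite (addrC h); field.
by rewrite normcM normcN ler_wpM2r// normc_ge0.
Qed.

Lemma cdiff_derivable f z d : cdiff f z d -> derivable (f : R[i]^o -> R[i]^o) z 1.
Proof.
move=> df; apply/cvg_ex; exists d; apply/cvgrPdist_le => e e0.
have er : e = (Re e)%:C by rewrite RRe_real// gtr0_real.
have /df[r r0 rH] : 0 < Re e by rewrite -ltcR -er.
apply/nbhs_ballP; exists r%:C => /=; first by rewrite ltcR.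
move=> h; rewrite /ball /= sub0r normrN normr_normc ltcR => hr h0.
rewrite normr_normc er lecR /shift /= /GRing.scale /= mulr1.
have -> : d - h^-1 * (f (h + z) - f z) = - (f (z + h) - f z - d * h) / h.
  by rewrite (addrC h); field.
rewrite normcM normcN normcV ler_pdivrMr ?normc_gt0//.
exact: rH.
Qed.

Lemma cdiff_eq f g z d : (exists2 r : R, 0 < r & forall h, normc h < r -> f (z + h) = g (z + h)) ->
  cdiff f z d -> cdiff g z d.
Proof.
move=> [r r0 fg] df e e0; have [s s0 sH] := df e e0.
exists (Num.min r s) => [|h]; first by rewrite lt_min r0.
rewrite lt_min => /andP[hr hs].
have := fg 0; rewrite normc0 addr0 => /(_ r0) <-; rewrite -fg//; exact: sH.
Qed.

Lemma cdiff_cst c z : cdiff (fun=> c) z 0.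
Proof.
move=> e e0; exists 1 => // h _; rewrite subrr mul0r subrr normc0.
by rewrite mulr_ge0 ?normc_ge0 ?ltW.
Qed.

Lemma cdiff_id z : cdiff id z 1.
Proof.
move=> e e0; exists 1 => // h _.
have -> : z + h - z - 1 * h = 0 by ring.
by rewrite normc0 mulr_ge0 ?normc_ge0 ?ltW.
Qed.

Lemma cdiffD f g z df dg : cdiff f z df -> cdiff g z dg ->
  cdiff (fun x => f x + g x) z (df + dg).
Proof.
move=> Hf Hg e e0; have e2 : 0 < e / 2 by lra.
have [r r0 rH] := Hf _ e2; have [s s0 sH] := Hg _ e2.
exists (Num.min r s) => [|h]; first by rewrite lt_min r0.
rewrite lt_min => /andP[hr hs].
have -> : f (z + h) + g (z + h) - (f z + g z) - (df + dg) * h =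
  (f (z + h) - f z - df * h) + (g (z + h) - g z - dg * h) by ring.
apply: le_trans (le_normcD _ _) _.
by have := rH h hr; have := sH h hs; lra.
Qed.

Lemma cdiff_lip f z d : cdiff f z d -> exists2 r : R, 0 < r &
  forall h, normc h < r -> normc (f (z + h) - f z) <= (normc d + 1) * normc h.
Proof.
move=> /(_ 1 ltr01)[r r0 rH]; exists r => // h hr.
have := rH h hr; have := le_normcD (f (z + h) - f z - d * h) (d * h).
by rewrite subrK normcM; lra.
Qed.

Lemma cdiffM f g z df dg : cdiff f z df -> cdiff g z dg ->
  cdiff (fun x => f x * g x) z (df * g z + f z * dg).
Proof.
move=> Hf Hg e e0.
have [u u0 uH] := cdiff_lip Hf; have [v v0 vH] := cdiff_lip Hg.
have nf := normc_ge0 (f z); have ng := normc_ge0 (g z).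
have ndf := normc_ge0 df; have ndg := normc_ge0 dg.
set K := normc (f z) + normc (g z) + 1.
have K0 : 0 < K by rewrite /K; lra.
have e3 : 0 < e / (2 * K) by rewrite divr_gt0// mulr_gt0.
have [r r0 rH] := Hf _ e3; have [s s0 sH] := Hg _ e3.
set L := (normc df + 1) * (normc dg + 1).
have L0 : 0 < L by rewrite /L; nra.
exists (Num.min (Num.min u v) (Num.min (Num.min r s) (e / (2 * L)))) => [|h].
  by rewrite !lt_min u0 v0 r0 s0 divr_gt0// mulr_gt0.
rewrite !lt_min => /andP[/andP[hu hv] /andP[/andP[hr hs] hL]].
have -> : f (z + h) * g (z + h) - f z * g z - (df * g z + f z * dg) * h =
  (f (z + h) - f z) * (g (z + h) - g z) +
  ((f (z + h) - f z - df * h) * g z + f z * (g (z + h) - g z - dg * h)) by ring.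
have h0 := normc_ge0 h.
have A := ler_pM (normc_ge0 _) (normc_ge0 _) (uH _ hu) (vH _ hv).
have A' : (normc df + 1) * normc h * ((normc dg + 1) * normc h) <= e / 2 * normc h.
  have -> : (normc df + 1) * normc h * ((normc dg + 1) * normc h) = (normc h * L) * normc h.
    by rewrite /L; ring.
  apply: ler_wpM2r => //; rewrite ltW// -ltr_pdivlMr//.
  by have -> : e / 2 / L = e / (2 * L) by field; rewrite gt_eqF.
have B : normc (f (z + h) - f z - df * h) * normc (g z) <= e / (2 * K) * normc h * normc (g z).
  by apply: ler_wpM2r => //; exact: rH.
have C : normc (f z) * normc (g (z + h) - g z - dg * h) <= normc (f z) * (e / (2 * K) * normc h).
  by apply: ler_wpM2l => //; exact: sH.
have D : e / (2 * K) * normc h * normc (g z) + normc (f z) * (e / (2 * K) * normc h) <= e / 2 * normc h.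
  have -> : e / 2 * normc h = e / (2 * K) * normc h * K by field; rewrite gt_eqF.
  rewrite /K; have : 0 <= e / (2 * K) * normc h by rewrite mulr_ge0// ltW.
  by nra.
apply: le_trans (le_normcD _ _) _.
have := le_normcD ((f (z + h) - f z - df * h) * g z) (f z * (g (z + h) - g z - dg * h)).
by rewrite !normcM; lra.
Qed.

Lemma cdiffZ c f z d : cdiff f z d -> cdiff (fun x => c * f x) z (c * d).
Proof. by move=> /(cdiffM (cdiff_cst c z)); rewrite mul0r add0r. Qed.

Lemma cdiffB f g z df dg : cdiff f z df -> cdiff g z dg ->
  cdiff (fun x => f x - g x) z (df - dg).
Proof.
move=> Hf /(cdiffZ (-1)) Hg; have := cdiffD Hf Hg; rewrite mulN1r.
by apply: cdiff_eq; exists 1 => // h _; rewrite mulN1r.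
Qed.

(** With w = f(z+h) - f(z), the error term is
(w^2 - (w - d h) f(z+h)) / (f(z+h) f(z)^2): the first summand is quadratic in h,
the second is small by hypothesis, and f(z+h) stays away from 0. *)
Lemma cdiffV f z d : f z != 0 -> cdiff f z d ->
  cdiff (fun x => (f x)^-1) z (- d / f z ^+ 2).
Proof.
move=> fz0 Hf e e0.
have [u u0 uH] := cdiff_lip Hf.
have nf : 0 < normc (f z) by rewrite normc_gt0.
have ndf := normc_ge0 d.
set N := normc (f z) in nf *.
set K := normc d + 1; have K0 : 0 < K by rewrite /K; lra.
have e1 : 0 < e * N ^+ 2 / 4 by rewrite !mulr_gt0// ?invr_gt0 ?exprn_gt0.
have [r r0 rH] := Hf _ e1.
pose t := Num.min (N / (2 * K)) (e * N ^+ 3 / (4 * K ^+ 2)).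
have t0 : 0 < t by rewrite lt_min !divr_gt0 ?mulr_gt0 ?exprn_gt0.
exists (Num.min (Num.min u r) t) => [|h]; first by rewrite lt_min t0 andbT lt_min u0 r0.
rewrite !lt_min => /andP[/andP[hu hr]]/andP[ht1 ht2].
have h0 := normc_ge0 h.
have A := uH h hu.
have B : normc (f (z + h) - f z) <= N / 2.
  apply: le_trans A _; move: ht1; rewrite ltr_pdivlMr ?mulr_gt0// -/K; lra.
have C : N / 2 <= normc (f (z + h)).
  by have := le_normc_sub (f z) (f z - f (z + h)); rewrite subKr normcB -/N; lra.
have fh0 : f (z + h) != 0 by rewrite -normc_gt0; lra.
set w := f (z + h) - f z in A B *.
have -> : (f (z + h))^-1 - (f z)^-1 - - d / f z ^+ 2 * h =
  (w ^+ 2 - (w - d * h) * f (z + h)) / (f (z + h) * f z ^+ 2).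
  by rewrite /w; field; rewrite fz0 fh0.
rewrite normcM normcV normcM normcX ler_pdivrMr; last first.
  by rewrite mulr_gt0 ?exprn_gt0// normc_gt0.
apply: le_trans (le_normcB _ _) _; rewrite normcX normcM.
rewrite -/N.
have D := rH h hr; rewrite -/w in D.
set F := normc (f (z + h)) in C *.
have W0 := normc_ge0 w.
have E1 : normc w ^+ 2 <= e * normc h * (F * N ^+ 2) / 2.
  apply: (@le_trans _ _ ((K * normc h) ^+ 2)); first by rewrite lerXn2r ?nnegrE// mulr_ge0// ltW.
  apply: (@le_trans _ _ (e * normc h * (N / 2 * N ^+ 2) / 2)); last first.
    rewrite ler_pM2r ?invr_gt0// ler_wpM2l ?ler_wpM2r ?sqr_ge0// mulr_ge0//; lra.
  move: ht2; rewrite ltr_pdivlMr ?mulr_gt0 ?exprn_gt0// => /ltW/(ler_wpM2r h0).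
  by rewrite !expr2 !exprS expr0 => ?; nra.
have E2 : normc (w - d * h) * F <= e * normc h * (F * N ^+ 2) / 2.
  apply: (@le_trans _ _ (e * N ^+ 2 / 4 * normc h * F)).
    by apply: ler_wpM2r => //; exact: normc_ge0.
  have : 0 <= e * normc h * (F * N ^+ 2).
    by rewrite !mulr_ge0// ?sqr_ge0 ?normc_ge0// ltW.
  by nra.
by move: E1 E2; rewrite -/F; lra.
Qed.

Lemma cdiff_exp f z d n : cdiff f z d ->
  exists d', cdiff (fun x => f x ^+ n) z d'.
Proof.
move=> df; elim: n => [|n [d' IH]].
  exists 0; have := cdiff_cst 1 z; apply: cdiff_eq; exists 1 => // h _.
exists (d * f z ^+ n + f z * d'); have := cdiffM df IH.
by apply: cdiff_eq; exists 1 => // h _; rewrite exprS.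
Qed.

End Cdiff.

(** * Integrals over boundaries of squares *)

Section Cint.
Variable R : realType.
Notation mu := (@lebesgue_measure R).
Implicit Types (g : R[i] -> R[i]) (h k : R -> R[i]) (a b c t : R).

Definition rcont h t := forall e : R, 0 < e -> exists2 r : R, 0 < r &
  forall s, `|s| < r -> normc (h (t + s) - h t) <= e.

Definition cintegral a b h : R[i] :=
  (\int[mu]_(t in `[a, b]) Re (h t)) +i* (\int[mu]_(t in `[a, b]) Im (h t)).

Let rcont_for (F : R[i] -> R) h t : (forall z w, F (z - w) = F z - F w) ->
  (forall z, `|F z| <= normc z) -> rcont h t -> {for t, continuous (fun s => F (h s))}.
Proof.
move=> FB Fle ht; apply/cvgrPdist_le => e e0.
have [r r0 rH] := ht e e0; apply/nbhs_ballP; exists r => //= s.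
rewrite /ball /= => ts; rewrite -FB; apply: le_trans (Fle _) _.
by rewrite normcB -[s](subrK t) (addrC _ t); apply: rH; rewrite distrC.
Qed.

Lemma ReB (z w : R[i]) : Re (z - w) = Re z - Re w. Proof. by case: z w => ? ? []. Qed.
Lemma ImB (z w : R[i]) : Im (z - w) = Im z - Im w. Proof. by case: z w => ? ? []. Qed.
Lemma ReD (z w : R[i]) : Re (z + w) = Re z + Re w. Proof. by case: z w => ? ? []. Qed.
Lemma ImD (z w : R[i]) : Im (z + w) = Im z + Im w. Proof. by case: z w => ? ? []. Qed.

Let rcont_integrable (F : R[i] -> R) a b h : (forall z w, F (z - w) = F z - F w) ->
  (forall z, `|F z| <= normc z) -> (forall t, a <= t <= b -> rcont h t) ->
  mu.-integrable `[a, b] (EFin \o (fun s => F (h s))).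
Proof.
move=> FB Fle ht; apply: continuous_compact_integrable; first exact: segment_compact.
apply: continuous_in_subspaceT => t /set_mem/= tab.
by apply: rcont_for => //; apply: ht; move: tab; rewrite in_itv.
Qed.

Lemma integrable_Re a b h : (forall t, a <= t <= b -> rcont h t) ->
  mu.-integrable `[a, b] (EFin \o (fun s => Re (h s))).
Proof. by move=> ht; apply: rcont_integrable => //; [exact: ReB|exact: le_Re]. Qed.

Lemma integrable_Im a b h : (forall t, a <= t <= b -> rcont h t) ->
  mu.-integrable `[a, b] (EFin \o (fun s => Im (h s))).
Proof. by move=> ht; apply: rcont_integrable => //; [exact: ImB|exact: le_Im]. Qed.

Lemma Rint_split (f : R -> R) a b c : a <= b -> b <= c ->
  mu.-integrable `[a, c] (EFin \o f) ->
  \int[mu]_(t in `[a, c]) f t =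
  \int[mu]_(t in `[a, b]) f t + \int[mu]_(t in `[b, c]) f t.
Proof.
move=> ab bc If.
have := @Rintegral_itvB R f (BLeft a) (BRight c) b If.
rewrite !bnd_simp => /(_ ab bc).
rewrite Rintegral_itv_obnd_cbnd; first by move=> <-; ring.
apply: integrableS If => //; apply: subset_itvr; by rewrite bnd_simp.
Qed.

Lemma cintegral_split a b c h : a <= b -> b <= c ->
  (forall t, a <= t <= c -> rcont h t) -> cintegral a c h = cintegral a b h + cintegral b c h.
Proof.
move=> ab bc ht; rewrite /cintegral (@Rint_split _ a b c)//; last exact: integrable_Re.
by rewrite (@Rint_split (fun t => Im (h t)) a b c)//; exact: integrable_Im.
Qed.

Lemma cintegralB a b h k : (forall t, a <= t <= b -> rcont h t) ->
  (forall t, a <= t <= b -> rcont k t) ->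
  cintegral a b h - cintegral a b k = cintegral a b (fun t => h t - k t).
Proof.
move=> ht kt; rewrite /cintegral.
under [in RHS]eq_Rintegral do rewrite ReB.
under [X in _ = _ +i* X]eq_Rintegral do rewrite ImB.
by rewrite !RintegralB//; (exact: integrable_Re || exact: integrable_Im).
Qed.

Lemma cintegral_cst a b (z : R[i]) : a <= b -> cintegral a b (fun=> z) = (b - a)%:C * z.
Proof.
move=> ab; rewrite /cintegral !Rintegral_cst//= lebesgue_measure_itv/= lte_fin.
case: z => x y; move: ab; rewrite le_eqVlt => /predU1P[->|->] /=.
  by rewrite ltxx subrr /= !mulr0; apply/eqP; rewrite eq_complex /= !mul0r subrr addr0 !eqxx.
by apply/eqP; rewrite eq_complex /=; apply/andP; split; apply/eqP; ring.
Qed.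

Lemma eq_cintegral a b h k : (forall t, a <= t <= b -> h t = k t) -> cintegral a b h = cintegral a b k.
Proof.
move=> hk; rewrite /cintegral; congr Complex; apply: eq_Rintegral => t;
  by rewrite inE/= in_itv/= => /hk ->.
Qed.

Let Rint_cst a b c : a <= b -> \int[mu]_(t in `[a, b]) c = c * (b - a).
Proof.
move=> ab; rewrite Rintegral_cst//= lebesgue_measure_itv/= lte_fin.
by move: ab; rewrite le_eqVlt => /predU1P[->|->] //=; rewrite ltxx subrr.
Qed.

Let integrable_cst a b c : mu.-integrable `[a, b] (EFin \o (fun=> c)).
Proof.
apply: continuous_compact_integrable; first exact: segment_compact.
by apply: continuous_subspaceT => ?; exact: cvg_cst.
Qed.

Let Rint_le (f : R -> R) a b (B : R) : a <= b ->
  mu.-integrable `[a, b] (EFin \o f) -> (forall t, a <= t <= b -> `|f t| <= B) ->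
  `|\int[mu]_(t in `[a, b]) f t| <= B * (b - a).
Proof.
move=> ab If fB; rewrite ler_norml -mulNr -!Rint_cst//; apply/andP; split;
  apply: le_Rintegral => //; try exact: integrable_cst.
  by move=> t /=; rewrite in_itv => /fB; rewrite ler_norml => /andP[].
by move=> t /=; rewrite in_itv => /fB; rewrite ler_norml => /andP[].
Qed.

(** The factor 2 comes from bounding the real and imaginary parts
separately. It is harmless because only the order of magnitude of the Cauchy
estimates is used. *)
Lemma cintegral_le a b h (B : R) : a <= b -> (forall t, a <= t <= b -> rcont h t) ->
  (forall t, a <= t <= b -> normc (h t) <= B) -> normc (cintegral a b h) <= 2 * B * (b - a).
Proof.
move=> ab ht hB; apply: le_trans (normc_le_ReIm _) _ => /=.
have -> : 2 * B * (b - a) = B * (b - a) + B * (b - a) by ring.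
apply: lerD; apply: Rint_le => //.
- exact: integrable_Re.
- by move=> t /hB; apply: le_trans; exact: le_Re.
- exact: integrable_Im.
- by move=> t /hB; apply: le_trans; exact: le_Im.
Qed.

Lemma cintegral_Im_ge a b h (B : R) : a <= b -> (forall t, a <= t <= b -> rcont h t) ->
  (forall t, a <= t <= b -> B <= Im (h t)) -> B * (b - a) <= Im (cintegral a b h).
Proof.
move=> ab ht hB; rewrite /= -Rint_cst//.
apply: le_Rintegral => //; try exact: integrable_cst; try exact: integrable_Im.
Qed.

Lemma cintegral_Re_ge a b h (B : R) : a <= b -> (forall t, a <= t <= b -> rcont h t) ->
  (forall t, a <= t <= b -> B <= Re (h t)) -> B * (b - a) <= Re (cintegral a b h).
Proof.
move=> ab ht hB; rewrite /= -Rint_cst//.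
apply: le_Rintegral => //; try exact: integrable_cst; try exact: integrable_Re.
Qed.

End Cint.

Section Square.
Variable R : realType.
Implicit Types (g : R[i] -> R[i]) (x y l : R).

(** The contour integral over the boundary of the square with lower left corner
(x, y) and side l, counterclockwise. *)
Definition square_integral g x y l : R[i] :=
  cintegral x (x + l) (fun t => g (t +i* y)) - cintegral x (x + l) (fun t => g (t +i* (y + l))) +
  'i%C * (cintegral y (y + l) (fun t => g ((x + l) +i* t)) - cintegral y (y + l) (fun t => g (x +i* t))).

Definition in_square x y l (z : R[i]) := (x <= Re z <= x + l) && (y <= Im z <= y + l).

Definition ccont g z := forall e : R, 0 < e -> exists2 r : R, 0 < r &
  forall h, normc h < r -> normc (g (z + h) - g z) <= e.

Lemma cdiff_cont g z d : cdiff g z d -> ccont g z.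
Proof.
move=> /cdiff_lip[r r0 rH] e e0; have K0 : 0 < normc d + 1 by have := normc_ge0 d; lra.
exists (Num.min r (e / (normc d + 1))) => [|h]; first by rewrite lt_min r0 divr_gt0.
rewrite lt_min => /andP[/rH hr]; rewrite ltr_pdivlMr// => he.
by apply: le_trans hr _; rewrite mulrC ltW.
Qed.

Lemma ccont_horizontal g t y : ccont g (t +i* y) -> rcont (fun t => g (t +i* y)) t.
Proof.
move=> gc e e0; have [r r0 rH] := gc e e0; exists r => // s sr.
have -> : (t + s) +i* y = (t +i* y) + s%:C by rewrite /real_complex_def; congr Complex => /=; ring.
by apply: rH; rewrite normcR.
Qed.

Lemma ccont_vertical g t x : ccont g (x +i* t) -> rcont (fun t => g (x +i* t)) t.
Proof.
move=> gc e e0; have [r r0 rH] := gc e e0; exists r => // s sr.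
have -> : x +i* (t + s) = (x +i* t) + 0 +i* s by rewrite /real_complex_def; congr Complex => /=; ring.
by apply: rH; rewrite /= expr0n add0r sqrtr_sqr.
Qed.

Lemma square_integral_split g x y l : 0 <= l -> (forall z, in_square x y (l + l) z -> ccont g z) ->
  square_integral g x y (l + l) = square_integral g x y l + square_integral g (x + l) y l +
    (square_integral g x (y + l) l + square_integral g (x + l) (y + l) l).
Proof.
move=> l0 gc; rewrite /square_integral !addrA.
have H u : y <= u <= y + l + l -> cintegral x (x + l + l) (fun t => g (t +i* u)) =
    cintegral x (x + l) (fun t => g (t +i* u)) + cintegral (x + l) (x + l + l) (fun t => g (t +i* u)).
  move=> u01; apply: cintegral_split; rewrite ?lerDl// => t t01; apply: ccont_horizontal; apply: gc.
  by rewrite /in_square /=; lra.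
have V u : x <= u <= x + l + l -> cintegral y (y + l + l) (fun t => g (u +i* t)) =
    cintegral y (y + l) (fun t => g (u +i* t)) + cintegral (y + l) (y + l + l) (fun t => g (u +i* t)).
  move=> u01; apply: cintegral_split; rewrite ?lerDl// => t t01; apply: ccont_vertical; apply: gc.
  by rewrite /in_square /=; lra.
rewrite !H ?V; [ring|lra..].
Qed.

Definition on_square x y l (z : R[i]) := in_square x y l z &&
  [|| Re z == x, Re z == x + l, Im z == y | Im z == y + l].

Lemma square_integral_le g x y l (B : R) : 0 <= l -> (forall z, on_square x y l z -> ccont g z) ->
  (forall z, on_square x y l z -> normc (g z) <= B) -> normc (square_integral g x y l) <= 8 * B * l.
Proof.
move=> l0 gc gB.
have H1 t : x <= t <= x + l -> on_square x y l (t +i* y).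
  by rewrite /on_square /in_square /= eqxx !orbT; lra.
have H2 t : x <= t <= x + l -> on_square x y l (t +i* (y + l)).
  by rewrite /on_square /in_square /= eqxx !orbT; lra.
have V1 t : y <= t <= y + l -> on_square x y l ((x + l) +i* t).
  by rewrite /on_square /in_square /= eqxx !orbT; lra.
have V2 t : y <= t <= y + l -> on_square x y l (x +i* t).
  by rewrite /on_square /in_square /= eqxx !orTb; lra.
rewrite /square_integral; apply: le_trans (le_normcD _ _) _.
rewrite normcM.
have -> : normc ('i%C : R[i]) = 1 by rewrite /= expr0n expr1n add0r sqrtr1.
rewrite mul1r.
have -> : 8 * B * l = (2 * B * l + 2 * B * l) + (2 * B * l + 2 * B * l) by ring.
have E u : l = u + l - u by ring.
apply: lerD; apply: le_trans (le_normcB _ _) _; apply: lerD.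
- rewrite {2}(E x); apply: cintegral_le; rewrite ?lerDl//.
    by move=> t /H1/gc/ccont_horizontal.
  by move=> t /H1/gB.
- rewrite {3}(E x); apply: cintegral_le; rewrite ?lerDl//.
    by move=> t /H2/gc/ccont_horizontal.
  by move=> t /H2/gB.
- rewrite {3}(E y); apply: cintegral_le; rewrite ?lerDl//.
    by move=> t /V1/gc/ccont_vertical.
  by move=> t /V1/gB.
- rewrite {2}(E y); apply: cintegral_le; rewrite ?lerDl//.
    by move=> t /V2/gc/ccont_vertical.
  by move=> t /V2/gB.
Qed.

Lemma square_integralB g k x y l : 0 <= l -> (forall z, on_square x y l z -> ccont g z) ->
  (forall z, on_square x y l z -> ccont k z) ->
  square_integral (fun z => g z - k z) x y l = square_integral g x y l - square_integral k x y l.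
Proof.
move=> l0 gc kc.
have H1 t : x <= t <= x + l -> on_square x y l (t +i* y).
  by rewrite /on_square /in_square /= eqxx !orbT; lra.
have H2 t : x <= t <= x + l -> on_square x y l (t +i* (y + l)).
  by rewrite /on_square /in_square /= eqxx !orbT; lra.
have V1 t : y <= t <= y + l -> on_square x y l ((x + l) +i* t).
  by rewrite /on_square /in_square /= eqxx !orbT; lra.
have V2 t : y <= t <= y + l -> on_square x y l (x +i* t).
  by rewrite /on_square /in_square /= eqxx !orTb; lra.
rewrite /square_integral -!cintegralB; first ring.
by move=> t /V2/gc/ccont_vertical.
by move=> t /V2/kc/ccont_vertical.
by move=> t /V1/gc/ccont_vertical.
by move=> t /V1/kc/ccont_vertical.
by move=> t /H2/gc/ccont_horizontal.
by move=> t /H2/kc/ccont_horizontal.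
by move=> t /H1/gc/ccont_horizontal.
by move=> t /H1/kc/ccont_horizontal.
Qed.

(** Opposite sides of the square contribute constant integrands, so no
antiderivative is needed. *)
Lemma square_integral_affine (a b : R[i]) x y l : 0 <= l -> square_integral (fun z => a + b * z) x y l = 0.
Proof.
move=> l0.
have gc z : ccont (fun z => a + b * z) z.
  by apply: cdiff_cont; apply: cdiffD; [exact: cdiff_cst|apply: cdiffZ; exact: cdiff_id].
have Hh u t : rcont (fun t => a + b * (t +i* u)) t by exact: (@ccont_horizontal _ _ _ (gc _)).
have Hv u t : rcont (fun t => a + b * (u +i* t)) t by exact: (@ccont_vertical _ _ _ (gc _)).
rewrite /square_integral !cintegralB//.
rewrite (@eq_cintegral _ _ _ _ (fun=> - b * (l *i)%C)); last first.
  move=> t _; case: a b {gc Hh Hv} => a1 a2 [b1 b2]; apply/eqP; rewrite eq_complex /=; apply/andP; split; apply/eqP; ring.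
rewrite (@eq_cintegral _ y _ _ (fun=> b * l%:C)); last first.
  move=> t _; case: a b {gc Hh Hv} => a1 a2 [b1 b2]; apply/eqP; rewrite eq_complex /=; apply/andP; split; apply/eqP; ring.
rewrite !cintegral_cst ?lerDl//.
case: b {gc Hh Hv} => b1 b2; apply/eqP; rewrite eq_complex /=; apply/andP; split; apply/eqP; ring.
Qed.

End Square.

(** * Goursat's theorem *)

Section Goursat.
Variable R : realType.
Implicit Types (g : R[i] -> R[i]) (x y l : R).

Lemma half_small (l e : R) : 0 < e -> exists n, l / 2 ^+ n < e.
Proof.
move=> e0; exists (Num.bound (`|l| / e)).
have := archi_boundP (divr_ge0 (normr_ge0 l) (ltW e0)).
set n := Num.bound _ => ln.
have n2 : n%:R <= 2 ^+ n :> R by rewrite -natrX ler_nat ltnW// ltn_expl.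
rewrite ltr_pdivrMr ?exprn_gt0//; apply: le_lt_trans (ler_norm l) _.
by move: (lt_le_trans ln n2); rewrite ltr_pdivrMr// mulrC.
Qed.

(** Nested intervals: X n is the left end of an interval of length l / 2^n which
contains the next one. *)
Lemma nested_half (X : nat -> R) (l : R) : 0 <= l ->
  (forall n, X n <= X n.+1 <= X n + l / 2 ^+ n.+1) ->
  exists a, forall n, X n <= a <= X n + l / 2 ^+ n.
Proof.
move=> l0 H.
have mono n m : X n <= X (n + m)%N.
  elim: m => [|m IH]; rewrite ?addn0// addnS; apply: le_trans IH _.
  by have /andP[] := H (n + m)%N.
have up n m : X (n + m)%N <= X n + l / 2 ^+ n - l / 2 ^+ (n + m).
  elim: m => [|m IH]; first by rewrite addn0; lra.
  have /andP[_] := H (n + m)%N; rewrite addnS.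
  have : l / 2 ^+ (n + m)%N = 2 * (l / 2 ^+ (n + m).+1).
    by rewrite exprS; field; rewrite expf_neq0.
  by move: IH; lra.
have ub n m : X m <= X n + l / 2 ^+ n.
  have q k : 0 <= l / 2 ^+ k by rewrite divr_ge0// exprn_ge0.
  case: (leqP n m) => nm.
    by have := up n (m - n)%N; rewrite subnKC//; have := q m; lra.
  have := mono m (n - m)%N; rewrite (subnKC (ltnW nm)) => h1.
  by rewrite (le_trans h1)// lerDl.
exists (sup (range X)) => n; apply/andP; split.
  by apply: ub_le_sup; [exists (X 0%N + l / 2 ^+ 0) => _ [m _ <-]|exists n].
by apply: ge_sup; [exists (X n); exists n|move=> _ [m _ <-]].
Qed.

(** Goursat's argument: if the integral were nonzero, one of the four quarters
would carry at least a quarter of it, and so on; but near the limit point of the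
nested squares the function is affine up to an error which is small compared
with the diameter. *)
Lemma goursat_square g x y l : 0 < l ->
  (forall z, in_square x y l z -> exists d, cdiff g z d) -> square_integral g x y l = 0.
Proof.
move=> l0 gd; apply/eqP; rewrite -normc_eq0 eq_le normc_ge0 andbT leNgt.
apply/negP => bad0.
pose e := normc (square_integral g x y l) / (2 * l ^+ 2).
have e0 : 0 < e by rewrite divr_gt0// mulr_gt0// exprn_gt0.
pose bad (p : R * R) r := e * r ^+ 2 < normc (square_integral g p.1 p.2 r).
have bad_start : bad (x, y) l.
  have -> : bad (x, y) l = (normc (square_integral g x y l) / 2 < normc (square_integral g x y l)).
    by rewrite /bad /e /=; congr (_ < _); field; rewrite gt_eqF.
  by lra.
(* the first of the four quarters that is still bad, the last one by default *)
pose nxt (p : R * R) r : R * R :=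
  if bad p r then p else if bad (p.1 + r, p.2) r then (p.1 + r, p.2)
  else if bad (p.1, p.2 + r) r then (p.1, p.2 + r) else (p.1 + r, p.2 + r).
have nxt_bd p r : 0 <= r -> (p.1 <= (nxt p r).1 <= p.1 + r) && (p.2 <= (nxt p r).2 <= p.2 + r).
  by move=> r0; rewrite /nxt; do 3?[case: ifP => _] => /=; lra.
have nxt_bad p r : 0 <= r -> (forall z, in_square p.1 p.2 (r + r) z -> ccont g z) ->
    bad p (r + r) -> bad (nxt p r) r.
  move=> r0 gc; rewrite {1}/bad square_integral_split// => b4.
  rewrite /nxt; case: ifPn => // /negbTE b1; case: ifPn => // /negbTE b2; case: ifPn => // /negbTE b3.
  move: b1 b2 b3; rewrite /bad => /negbT; rewrite -leNgt => b1 /negbT; rewrite -leNgt => b2 /negbT; rewrite -leNgt => b3.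
  move: b4 b1 b2 b3; rewrite ![(_, _).1]/= ![(_, _).2]/=.
  set A := square_integral _ _ _ _; set B := square_integral _ _ _ _; set C := square_integral _ _ _ _; set D := square_integral _ _ _ _.
  have := le_normcD (A + B) (C + D); have := le_normcD A B; have := le_normcD C D.
  by lra.
pose pos := fix pos n : R * R := if n is m.+1 then nxt (pos m) (l / 2 ^+ m.+1) else (x, y).
have q k : 0 < l / 2 ^+ k by rewrite divr_gt0// exprn_gt0.
have hs k : l / 2 ^+ k.+1 + l / 2 ^+ k.+1 = l / 2 ^+ k by rewrite exprS; field; rewrite expf_neq0.
have [a Ha] : exists a, forall n, (pos n).1 <= a <= (pos n).1 + l / 2 ^+ n.
  apply: (@nested_half (fun n => (pos n).1)); first exact: ltW.
  by move=> n; have /andP[] := nxt_bd (pos n) _ (ltW (q n.+1)).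
have [b Hb] : exists b, forall n, (pos n).2 <= b <= (pos n).2 + l / 2 ^+ n.
  apply: (@nested_half (fun n => (pos n).2)); first exact: ltW.
  by move=> n; have /andP[] := nxt_bd (pos n) _ (ltW (q n.+1)).
have sub n z : in_square (pos n).1 (pos n).2 (l / 2 ^+ n) z -> in_square x y l z.
  elim: n z => [|n IH] z; first by rewrite /= expr0 divr1.
  move=> H; apply: IH; move: H.
  have := nxt_bd (pos n) _ (ltW (q n.+1)); rewrite -[nxt _ _]/(pos n.+1) /in_square.
  by have := hs n; have := q n.+1; lra.
have badn n : bad (pos n) (l / 2 ^+ n).
  elim: n => [|n IH]; first by rewrite /= expr0 divr1.
  apply: nxt_bad; [exact: ltW| |by rewrite hs].
  move=> z; rewrite hs => /sub/gd[d]; exact: cdiff_cont.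
have [d gz] : exists d, cdiff g (a +i* b) d.
  by apply: gd; apply: (sub 0%N); rewrite /in_square /= (Ha 0%N) (Hb 0%N).
(* the error at distance 2 s is at most e/32 * 2 s on a boundary of length 4 s;
   with the factor 2 of [cintegral_le] this is half of e * s^2 *)
have e32 : 0 < e / 32 by lra.
have [r r0 rH] := gz _ e32.
have [n nr] : exists n, l / 2 ^+ n < r / 2 by apply: half_small; lra.
have := badn n; rewrite /bad ltNge => /negP; apply.
set s := l / 2 ^+ n in nr *; set p := pos n.
have s0 : 0 < s by exact: q.
have inq z : in_square p.1 p.2 s z -> normc (z - (a +i* b)) <= 2 * s.
  move=> zs; apply: le_trans (normc_le_ReIm _) _.
  have := Ha n; have := Hb n; rewrite -/p -/s; move: zs; case: z => z1 z2.
  rewrite /in_square /= => /andP[z1s z2s] bs as'.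
  have -> : 2 * s = s + s by ring.
  by apply: lerD; rewrite ler_norml; lra.
pose A := g (a +i* b) - d * (a +i* b).
have gc z : on_square p.1 p.2 s z -> ccont g z.
  by move=> /andP[/sub/gd[d' +] _]; exact: cdiff_cont.
have Ac z : ccont (fun z => A + d * z) z.
  by apply: cdiff_cont; apply: cdiffD; [exact: cdiff_cst|apply: cdiffZ; exact: cdiff_id].
have -> : square_integral g p.1 p.2 s = square_integral (fun z => g z - (A + d * z)) p.1 p.2 s.
  by rewrite square_integralB ?square_integral_affine ?subr0// ltW.
have -> : e * s ^+ 2 = 8 * (e / 32 * (2 * s)) * s * 2 by field.
apply: (@le_trans _ _ (8 * (e / 32 * (2 * s)) * s)).
  apply: square_integral_le; first exact: ltW.
    move=> z /gc Hz u u0; have u2 : 0 < u / 2 by lra.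
    have [r1 r10 H1] := Hz _ u2; have [r2 r20 H2] := Ac z _ u2.
    exists (Num.min r1 r2) => [|h]; first by rewrite lt_min r10.
    rewrite lt_min => /andP[/H1 h1 /H2 h2].
    have -> : g (z + h) - (A + d * (z + h)) - (g z - (A + d * z)) =
      (g (z + h) - g z) - (A + d * (z + h) - (A + d * z)) by ring.
    by apply: le_trans (le_normcB _ _) _; lra.
  move=> z /andP[zs _]; have zr := inq z zs.
  have := rH (z - (a +i* b)); rewrite (addrC (a +i* b)) subrK.
  have -> : g z - g (a +i* b) - d * (z - (a +i* b)) = g z - (A + d * z) by rewrite /A; ring.
  have hr : normc (z - (a +i* b)) < r by lra.
  move=> /(_ hr) H; apply: le_trans H _; rewrite ler_pM2l//.
have : 0 < e * s * s by exact: mulr_gt0 (mulr_gt0 e0 s0) s0.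
by lra.
Qed.


(** A square minus the concentric square of half the side is a union of twelve
squares of a quarter of the side, none of which contains the centre. *)
Lemma square_integral_annulus g x y h : 0 < h ->
  (forall z, in_square x y (h + h + h + h) z -> z != (x + h + h) +i* (y + h + h) ->
    exists d, cdiff g z d) ->
  square_integral g x y (h + h + h + h) = square_integral g (x + h) (y + h) (h + h).
Proof.
move=> h0 gd.
have gc t u : x <= t <= x + h + h + h + h -> y <= u <= y + h + h + h + h ->
    (t != x + h + h) || (u != y + h + h) -> exists d, cdiff g (t +i* u) d.
  move=> t01 u01 tu; apply: gd; first by rewrite /in_square /= !addrA t01 u01.
  by rewrite eq_complex /= negb_and.
have H0 x1 x2 u t : x <= x1 -> x2 <= x + h + h + h + h -> y <= u <= y + h + h + h + h ->
    u != y + h + h -> x1 <= t <= x2 -> rcont (fun t => g (t +i* u)) t.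
  move=> x1x x2x u01 u1 t12; apply: ccont_horizontal.
  have tb : x <= t <= x + h + h + h + h by lra.
  have tu : (t != x + h + h) || (u != y + h + h) by rewrite u1 orbT.
  by have [d] := gc t u tb u01 tu; exact: cdiff_cont.
have V0 y1 y2 u t : y <= y1 -> y2 <= y + h + h + h + h -> x <= u <= x + h + h + h + h ->
    u != x + h + h -> y1 <= t <= y2 -> rcont (fun t => g (u +i* t)) t.
  move=> x1x x2x u01 u1 t12; apply: ccont_vertical.
  have tb : y <= t <= y + h + h + h + h by lra.
  have tu : (u != x + h + h) || (t != y + h + h) by rewrite u1.
  by have [d] := gc u t u01 tb tu; exact: cdiff_cont.
have H2 u : y <= u <= y + h + h + h + h -> u != y + h + h ->
    cintegral (x + h) (x + h + h + h) (fun t => g (t +i* u)) =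
    cintegral (x + h) (x + h + h) (fun t => g (t +i* u)) +
    cintegral (x + h + h) (x + h + h + h) (fun t => g (t +i* u)).
  move=> u01 u1; apply: cintegral_split; rewrite ?lerDl ?(ltW h0)// => t.
  by apply: H0 => //; lra.
have H4 u : y <= u <= y + h + h + h + h -> u != y + h + h ->
    cintegral x (x + h + h + h + h) (fun t => g (t +i* u)) =
    cintegral x (x + h) (fun t => g (t +i* u)) +
    cintegral (x + h) (x + h + h + h) (fun t => g (t +i* u)) +
    cintegral (x + h + h + h) (x + h + h + h + h) (fun t => g (t +i* u)).
  move=> u01 u1; rewrite (@cintegral_split _ x (x + h + h + h)); [|lra|lra|by move=> t; apply: H0 => //; lra].
  rewrite (@cintegral_split _ x (x + h)); [by []|lra|lra|by move=> t; apply: H0 => //; lra].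
have V2 u : x <= u <= x + h + h + h + h -> u != x + h + h ->
    cintegral (y + h) (y + h + h + h) (fun t => g (u +i* t)) =
    cintegral (y + h) (y + h + h) (fun t => g (u +i* t)) +
    cintegral (y + h + h) (y + h + h + h) (fun t => g (u +i* t)).
  move=> u01 u1; apply: cintegral_split; rewrite ?lerDl ?(ltW h0)// => t.
  by apply: V0 => //; lra.
have V4 u : x <= u <= x + h + h + h + h -> u != x + h + h ->
    cintegral y (y + h + h + h + h) (fun t => g (u +i* t)) =
    cintegral y (y + h) (fun t => g (u +i* t)) +
    cintegral (y + h) (y + h + h + h) (fun t => g (u +i* t)) +
    cintegral (y + h + h + h) (y + h + h + h + h) (fun t => g (u +i* t)).
  move=> u01 u1; rewrite (@cintegral_split _ y (y + h + h + h)); [|lra|lra|by move=> t; apply: V0 => //; lra].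
  rewrite (@cintegral_split _ y (y + h)); [by []|lra|lra|by move=> t; apply: V0 => //; lra].
have Z x1 y1 : x <= x1 -> x1 + h <= x + h + h + h + h -> y <= y1 -> y1 + h <= y + h + h + h + h ->
    (x + h + h < x1) || (x1 + h < x + h + h) || (y + h + h < y1) || (y1 + h < y + h + h) ->
    square_integral g x1 y1 h = 0.
  move=> a1 a2 a3 a4 out; apply: goursat_square => // -[t u]; rewrite /in_square /= => /andP[t01 u01].
  apply: gc; [lra|lra|].
  have [te|//] := eqVneq t (x + h + h); have [ue|//] := eqVneq u (y + h + h).
  by exfalso; move: out; rewrite te in t01; rewrite ue in u01; lra.
have Z00 : square_integral g x y h = 0 by apply: Z; lra.
have Z01 : square_integral g x (y + h) h = 0 by apply: Z; lra.
have Z02 : square_integral g x (y + h + h) h = 0 by apply: Z; lra.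
have Z03 : square_integral g x (y + h + h + h) h = 0 by apply: Z; lra.
have Z10 : square_integral g (x + h) y h = 0 by apply: Z; lra.
have Z13 : square_integral g (x + h) (y + h + h + h) h = 0 by apply: Z; lra.
have Z20 : square_integral g (x + h + h) y h = 0 by apply: Z; lra.
have Z23 : square_integral g (x + h + h) (y + h + h + h) h = 0 by apply: Z; lra.
have Z30 : square_integral g (x + h + h + h) y h = 0 by apply: Z; lra.
have Z31 : square_integral g (x + h + h + h) (y + h) h = 0 by apply: Z; lra.
have Z32 : square_integral g (x + h + h + h) (y + h + h) h = 0 by apply: Z; lra.
have Z33 : square_integral g (x + h + h + h) (y + h + h + h) h = 0 by apply: Z; lra.
have E : square_integral g x y h +
  square_integral g x (y + h) h +
  square_integral g x (y + h + h) h +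
  square_integral g x (y + h + h + h) h +
  square_integral g (x + h) y h +
  square_integral g (x + h) (y + h + h + h) h +
  square_integral g (x + h + h) y h +
  square_integral g (x + h + h) (y + h + h + h) h +
  square_integral g (x + h + h + h) y h +
  square_integral g (x + h + h + h) (y + h) h +
  square_integral g (x + h + h + h) (y + h + h) h +
  square_integral g (x + h + h + h) (y + h + h + h) h = 0.
  by rewrite Z00 Z01 Z02 Z03 Z10 Z13 Z20 Z23 Z30 Z31 Z32 Z33; ring.
clear Z; apply/eqP; rewrite -subr_eq0 -E; apply/eqP; clear E.
rewrite /square_integral.
have -> : x + (h + h + h + h) = x + h + h + h + h by rewrite !addrA.
have -> : y + (h + h + h + h) = y + h + h + h + h by rewrite !addrA.
have -> : x + h + (h + h) = x + h + h + h by rewrite !addrA.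
have -> : y + h + (h + h) = y + h + h + h by rewrite !addrA.
have N0 t : t != t + h + h by rewrite lt_eqF//; lra.
have N1 t : t + h != t + h + h by rewrite lt_eqF//; lra.
have N3 t : t + h + h + h != t + h + h by rewrite gt_eqF//; lra.
have N4 t : t + h + h + h + h != t + h + h by rewrite gt_eqF//; lra.
have B0 t : t <= t <= t + h + h + h + h by lra.
have B1 t : t <= t + h <= t + h + h + h + h by lra.
have B3 t : t <= t + h + h + h <= t + h + h + h + h by lra.
have B4 t : t <= t + h + h + h + h <= t + h + h + h + h by lra.
rewrite (H4 _ (B0 y) (N0 y)) (H4 _ (B4 y) (N4 y)) (V4 _ (B0 x) (N0 x)) (V4 _ (B4 x) (N4 x)).
rewrite (H2 _ (B0 y) (N0 y)) (H2 _ (B4 y) (N4 y)) (V2 _ (B0 x) (N0 x)) (V2 _ (B4 x) (N4 x)).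
rewrite (H2 _ (B1 y) (N1 y)) (H2 _ (B3 y) (N3 y)) (V2 _ (B1 x) (N1 x)) (V2 _ (B3 x) (N3 x)).
do ?[move: (cintegral _ _ _) => ?].
ring.
Qed.

Lemma on_square_dist a b l z : 0 < l -> on_square (a - l) (b - l) (l + l) z -> l <= normc (z - (a +i* b)).
Proof.
move=> l0; have := le_Re (z - (a +i* b)); have := le_Im (z - (a +i* b)).
case: z => t u; rewrite /on_square /in_square /= => A B /andP[_ tu].
have [H|H] : (l <= `|u - b|) \/ (l <= `|t - a|).
  case/or4P: tu => /eqP ->.
  - by right; rewrite distrC ler_normr; apply/orP; left; lra.
  - by right; rewrite ler_normr; apply/orP; left; lra.
  - by left; rewrite distrC ler_normr; apply/orP; left; lra.
  - by left; rewrite ler_normr; apply/orP; left; lra.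
- exact: le_trans H A.
- exact: le_trans H B.
Qed.

(** By [square_integral_annulus] the integral does not change when the square is
halved; on a square of half-side h it is at most a constant times h sup |g|,
which tends to 0. *)
Lemma goursat_punctured_square g (a b l : R) : 0 < l ->
  (forall z, in_square (a - l) (b - l) (l + l) z -> z != a +i* b -> exists d, cdiff g z d) ->
  (forall e : R, 0 < e -> exists2 r : R, 0 < r & forall z, 0 < normc (z - (a +i* b)) < r ->
     normc (z - (a +i* b)) * normc (g z) <= e) ->
  square_integral g (a - l) (b - l) (l + l) = 0.
Proof.
move=> l0 gd gs; apply/eqP; rewrite -normc_eq0 eq_le normc_ge0 andbT.
pose L n := l / 2 ^+ n.
have L0 n : 0 < L n by rewrite divr_gt0// exprn_gt0.
have L2 n : L n = L n.+1 + L n.+1 by rewrite /L exprS; field; rewrite expf_neq0.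
have LM n : L n <= l.
  elim: n => [|n IH]; first by rewrite /L expr0 divr1.
  by apply: le_trans IH; rewrite (L2 n) lerDl ltW.
have E n : square_integral g (a - l) (b - l) (l + l) = square_integral g (a - L n) (b - L n) (L n + L n).
  elim: n => [|n ->]; first by rewrite /L expr0 divr1.
  have ln := LM n; have h0 := L0 n.+1; rewrite (L2 n) in ln *.
  set h := L n.+1 in ln h0 *.
  have -> : h + h + (h + h) = h + h + h + h by rewrite !addrA.
  have ea u : u - (h + h) + h + h = u by ring.
  have eb u : u - (h + h) + h = u - h by ring.
  rewrite (square_integral_annulus h0); first by rewrite !eb.
  move=> z; rewrite !ea => zin; apply: gd; move: zin.
  by rewrite /in_square; lra.
apply/ler_addgt0Pr => e e0; rewrite add0r.
have e16 : 0 < e / 16 by lra.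
have [r r0 rH] := gs _ e16.
have [n nr] : exists n, L n < r / 2 by apply: half_small; lra.
rewrite (E n); set h := L n in nr *; have h0 : 0 < h := L0 n.
have bd z : on_square (a - h) (b - h) (h + h) z -> h <= normc (z - (a +i* b)) < r.
  move=> zb; apply/andP; split.
    exact: on_square_dist zb.
  apply: le_lt_trans (normc_le_ReIm _) _.
  move: zb; case: z => t u; rewrite /on_square /in_square /= => /andP[tu _].
  have A : `|t - a| <= h by rewrite ler_norml; lra.
  have B : `|u - b| <= h by rewrite ler_norml; lra.
  by apply: le_lt_trans (lerD A B) _; lra.
have -> : e = 8 * (e / 16 / h) * (h + h) by field; rewrite gt_eqF.
apply: square_integral_le; first by lra.
  move=> z zb; have /andP[zh _] := bd z zb.
  have [||d] := gd z.
  - move: zb => /andP[+ _]; rewrite /in_square; have := LM n; rewrite -/h; lra.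
  - by apply/eqP => ze; move: zh; rewrite ze subrr normc0; lra.
  - exact: cdiff_cont.
move=> z zb; have /andP[zh zr] := bd z zb.
rewrite ler_pdivlMr// mulrC; apply: le_trans (rH z _); last by lra.
by apply: ler_wpM2r => //; exact: normc_ge0.
Qed.
End Goursat.

(** * Cauchy estimates *)

Section CauchyEstimate.
Variable R : realType.
Implicit Types (f q : R[i] -> R[i]) (a b l M : R).

Lemma ccont_inv_dist (c z : R[i]) : z != c -> ccont (fun z => (z - c)^-1) z.
Proof.
move=> zc; apply: cdiff_cont; apply: cdiffV; first by rewrite subr_eq0.
by apply: cdiffB; [exact: cdiff_id|exact: cdiff_cst].
Qed.

(** The integral of 1 / (z - c) is 2 pi i, but a positive lower bound is enough:
for each pair of opposite sides, a component of the difference of the integrands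
is at least 1/l. *)
Lemma square_integral_inv_ge a b l : 0 < l ->
  4 <= normc (square_integral (fun z => (z - (a +i* b))^-1) (a - l) (b - l) (l + l)).
Proof.
move=> l0; set k := fun z => _.
have kc t u : (t != a) || (u != b) -> ccont k (t +i* u).
  by move=> tu; apply: ccont_inv_dist; rewrite eq_complex /= negb_and.
have n1 u : u - l != u by rewrite lt_eqF//; lra.
have n2 u : u - l + (l + l) != u by rewrite gt_eqF//; lra.
have Hh t u : u != b -> rcont (fun t => k (t +i* u)) t.
  by move=> ub; apply: ccont_horizontal; apply: kc; rewrite ub orbT.
have Hv t u : u != a -> rcont (fun t => k (u +i* t)) t.
  by move=> ub; apply: ccont_vertical; apply: kc; rewrite ub.
have sB h1 h2 t : rcont h1 t -> rcont h2 t -> rcont (fun t => h1 t - h2 t : R[i]) t.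
  move=> H1 H2 u u0; have u2 : 0 < u / 2 by lra.
  have [r1 r10 {}H1] := H1 _ u2; have [r2 r20 {}H2] := H2 _ u2.
  exists (Num.min r1 r2) => [|s]; first by rewrite lt_min r10.
  rewrite lt_min => /andP[/H1 a1 /H2 a2].
  have -> : h1 (t + s) - h2 (t + s) - (h1 t - h2 t) = (h1 (t + s) - h1 t) - (h2 (t + s) - h2 t) by ring.
  by apply: le_trans (le_normcB _ _) _; lra.
have bnd u : - l <= u <= l -> l^-1 <= 2 * l / (u ^+ 2 + l ^+ 2).
  move=> ul; rewrite ler_pdivlMr; last by have : 0 < l * l by [exact: mulr_gt0]; nra.
  by rewrite mulrC ler_pdivrMr//; nra.
have EH : cintegral (a - l) (a - l + (l + l)) (fun t => k (t +i* (b - l))) -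
    cintegral (a - l) (a - l + (l + l)) (fun t => k (t +i* (b - l + (l + l)))) =
    cintegral (a - l) (a - l + (l + l)) (fun t => k (t +i* (b - l)) - k (t +i* (b - l + (l + l)))).
  by apply: cintegralB => t _; apply: Hh.
have EV : cintegral (b - l) (b - l + (l + l)) (fun t => k ((a - l + (l + l)) +i* t)) -
    cintegral (b - l) (b - l + (l + l)) (fun t => k ((a - l) +i* t)) =
    cintegral (b - l) (b - l + (l + l)) (fun t => k ((a - l + (l + l)) +i* t) - k ((a - l) +i* t)).
  by apply: cintegralB => t _; apply: Hv.
rewrite /square_integral EH EV {EH EV}.
set H := cintegral _ _ _; set V := cintegral _ _ _.
apply: le_trans (le_trans (ler_norm _) (le_Im _)).
have -> : Im (H + 'i%C * V) = Im H + Re V by case: H V => ? ? [? ?] /=; ring.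
have -> : 4 = l^-1 * (a - l + (l + l) - (a - l)) + l^-1 * (b - l + (l + l) - (b - l)) :> R.
  by field; rewrite gt_eqF.
apply: lerD.
- apply: cintegral_Im_ge => [|t _|t ht]; first by lra.
    by apply: sB; exact: Hh.
  apply: le_trans (bnd (t - a) _) _; first by lra.
  rewrite le_eqVlt; apply/orP; left; apply/eqP; rewrite /k ImB /=.
  have : (t - a) ^+ 2 + l ^+ 2 != 0 by rewrite gt_eqF// ltr_wpDl ?sqr_ge0// exprn_gt0.
  have -> : b - l - b = - l by ring.
  have -> : b - l + (l + l) - b = l by ring.
  by rewrite addrC => nz; field; rewrite ?sqrrN ?nz // addrC nz.
- apply: cintegral_Re_ge => [|t _|t ht]; first by lra.
    by apply: sB; exact: Hv.
  apply: le_trans (bnd (t - b) _) _; first by lra.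
  rewrite le_eqVlt; apply/orP; left; apply/eqP; rewrite /k ReB /=.
  have : (t - b) ^+ 2 + l ^+ 2 != 0 by rewrite gt_eqF// ltr_wpDl ?sqr_ge0// exprn_gt0.
  have -> : a - l - a = - l by ring.
  have -> : a - l + (l + l) - a = l by ring.
  by rewrite addrC => nz; field; rewrite sqrrN nz.
Qed.

Lemma ccontM f g z : ccont f z -> ccont g z -> ccont (fun x => f x * g x) z.
Proof.
move=> fc gc e e0.
set N := normc (f z) + normc (g z) + 1.
have N0 : 0 < N by rewrite /N; have := normc_ge0 (f z); have := normc_ge0 (g z); lra.
pose d := Num.min 1 (e / (2 * N)).
have d0 : 0 < d by rewrite lt_min ltr01 divr_gt0 ?mulr_gt0.
have [r1 r10 H1] := fc _ d0; have [r2 r20 H2] := gc _ d0.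
exists (Num.min r1 r2) => [|h]; first by rewrite lt_min r10.
rewrite lt_min => /andP[/H1 a1 /H2 a2].
have -> : f (z + h) * g (z + h) - f z * g z =
  (f (z + h) - f z) * (g (z + h) - g z) + (f (z + h) - f z) * g z + f z * (g (z + h) - g z) by ring.
have d1 : d <= 1 by rewrite ge_min lexx.
have dN : 2 * (d * N) <= e.
  have : d <= e / (2 * N) by rewrite ge_min lexx orbT.
  by rewrite ler_pdivlMr ?mulr_gt0//; lra.
apply: le_trans (le_normcD _ _) _; rewrite normcM.
apply: le_trans (lerD (le_normcD _ _) (lexx _)) _; rewrite !normcM.
have b1 := ler_pM (normc_ge0 _) (normc_ge0 _) a1 a2.
have b2 : normc (f (z + h) - f z) * normc (g z) <= d * normc (g z) by rewrite ler_wpM2r// normc_ge0.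
have b3 : normc (f z) * normc (g (z + h) - g z) <= normc (f z) * d by rewrite ler_wpM2l// normc_ge0.
have b4 : d * d <= d by rewrite ler_piMr// ltW.
move: dN; rewrite {1}/N.
have q0 : 0 <= d * N by rewrite mulr_ge0 ?(ltW d0) ?(ltW N0).
move: q0; rewrite /N; lra.
Qed.

(** Integrate (q(z) - q(c)) / (z - c) around c: the integral vanishes by
[goursat_punctured_square], so q(c) times the integral of 1 / (z - c) is the
integral of q(z) / (z - c). Differentiability at c itself is not assumed; this
is what allows difference quotients for q. *)
Lemma cauchy_maximum_bound q a b l M : 0 < l -> ccont q (a +i* b) ->
  (forall z, in_square (a - l) (b - l) (l + l) z -> z != a +i* b -> exists d, cdiff q z d) ->
  (forall z, on_square (a - l) (b - l) (l + l) z -> normc (q z) <= M) ->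
  normc (q (a +i* b)) <= 4 * M.
Proof.
move=> l0 qc qd qM; set c := a +i* b.
have M0 : 0 <= M.
  apply: le_trans (qM ((a - l) +i* (b - l)) _); first exact: normc_ge0.
  by rewrite /on_square /in_square /= eqxx !lexx /=; lra.
have [->|qc0] := eqVneq (q c) 0; first by rewrite normc0 mulr_ge0.
have nq : 0 < normc (q c) by rewrite normc_gt0.
(* normalizing the value at c to 1 avoids homogeneity of the contour integral *)
pose q1 z := (q c)^-1 * q z.
have bdc z : on_square (a - l) (b - l) (l + l) z -> z != c.
  by move=> /(on_square_dist l0); apply: contraTneq => ->; rewrite subrr normc0 -ltNge.
have q1d z d : cdiff q z d -> cdiff q1 z ((q c)^-1 * d) by exact: cdiffZ.
have kd z : z != c -> exists d, cdiff (fun z => (z - c)^-1) z d.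
  move=> zc; eexists; apply: cdiffV; first by rewrite subr_eq0.
  by apply: cdiffB; [exact: cdiff_id|exact: cdiff_cst].
have Z : square_integral (fun z => q1 z * (z - c)^-1 - (z - c)^-1) (a - l) (b - l) (l + l) = 0.
  apply: goursat_punctured_square => //.
    move=> z zin zc; have [d1 H1] := qd z zin zc; have [d2 H2] := kd z zc.
    by eexists; apply: cdiffB; [apply: cdiffM; [exact: q1d H1|exact: H2]|exact: H2].
  move=> e e0; have e1 : 0 < e * normc (q c) by rewrite mulr_gt0.
  have [r r0 rH] := qc _ e1; exists r => // z /andP[z0 zr].
  have zc : z - c != 0 by rewrite -normc_gt0.
  have -> : q1 z * (z - c)^-1 - (z - c)^-1 = (q c)^-1 * (q z - q c) / (z - c).
    by rewrite /q1; field; rewrite qc0 zc.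
  rewrite normcM (normcM _ (q z - q c)) !normcV mulrC divfK ?gt_eqF//.
  rewrite ler_pdivrMl// mulrC.
  by have := rH (z - c) zr; rewrite (addrC (a +i* b)) subrK.
have q1k z : on_square (a - l) (b - l) (l + l) z -> ccont (fun z => q1 z * (z - c)^-1) z.
  move=> zb; have zc := bdc z zb; have /andP[zin _] := zb.
  have [d1 H1] := qd z zin zc; have [d2 H2] := kd z zc.
  by apply: ccontM; [exact: cdiff_cont (q1d _ _ H1)|exact: cdiff_cont H2].
move: Z; rewrite square_integralB//; [|by lra|by move=> z /bdc /kd[d]; exact: cdiff_cont].
move/eqP; rewrite subr_eq0 => /eqP E.
have := square_integral_inv_ge a b l0; rewrite -E.
have : normc (square_integral (fun z => q1 z * (z - c)^-1) (a - l) (b - l) (l + l))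
    <= 8 * (M / normc (q c) / l) * (l + l).
  apply: square_integral_le => //; first by lra.
  move=> z zb; rewrite normcM normcV ler_pM ?invr_ge0 ?normc_ge0//.
    by rewrite /q1 normcM normcV mulrC ler_pM2r ?invr_gt0// qM.
  have zd := on_square_dist l0 zb.
  by rewrite lef_pV2 ?posrE//; exact: lt_le_trans zd.
have -> : 8 * (M / normc (q c) / l) * (l + l) = 16 * M / normc (q c).
  by field; rewrite !gt_eqF.
move=> H1 H2; have := le_trans H2 H1; rewrite ler_pdivlMr//; lra.
Qed.

(** [cauchy_maximum_bound] for the difference quotient of f at c, whose value at c
is f'(c). *)
Lemma cauchy_derivative_bound f (c d : R[i]) l M : 0 < l ->
  (forall z, normc (z - c) <= 2 * l -> (exists d, cdiff f z d) /\ normc (f z) <= M) ->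
  cdiff f c d -> normc d <= 8 * M / l.
Proof.
case: c => a b l0 fH fd; set c := a +i* b.
have sqc z : in_square (a - l) (b - l) (l + l) z -> normc (z - c) <= 2 * l.
  move=> zin; apply: le_trans (normc_le_ReIm _) _.
  move: zin; case: z => t u; rewrite /in_square /= => tu.
  have A : `|t - a| <= l by rewrite ler_norml; lra.
  have B : `|u - b| <= l by rewrite ler_norml; lra.
  by apply: le_trans (lerD A B) _; lra.
pose q z := if z == c then d else (f z - f c) / (z - c).
have -> : d = q c by rewrite /q eqxx.
have -> : 8 * M / l = 4 * (2 * M / l) by field; rewrite gt_eqF.
apply: (@cauchy_maximum_bound _ _ _ l) => //.
- move=> e e0; have [r r0 rH] := fd _ e0; exists r => // h hr.
  rewrite {2}/q eqxx /q; case: eqVneq => [_|hc]; first by rewrite subrr normc0 ltW.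
  have h0 : h != 0 by apply: contra_neq hc => ->; rewrite addr0.
  have -> : a +i* b + h - c = h by rewrite /c; ring.
  have -> : (f (a +i* b + h) - f c) / h - d = (f (c + h) - f c - d * h) / h by rewrite -/c; field.
  by rewrite normcM normcV ler_pdivrMr ?normc_gt0//; exact: rH.
- move=> z zin zc; have [[d1 fz] _] := fH z (sqc z zin).
  have zc0 : z - c != 0 by rewrite subr_eq0.
  have : exists d, cdiff (fun z => (f z - f c) * (z - c)^-1) z d.
    eexists; apply: cdiffM.
      by apply: cdiffB; [exact: fz|exact: cdiff_cst].
    apply: cdiffV => //.
    by apply: cdiffB; [exact: cdiff_id|exact: cdiff_cst].
  move=> [d2 H]; exists d2; apply: cdiff_eq H.
  exists (normc (z - c)); first by rewrite normc_gt0.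
  move=> h hz; rewrite /q; case: eqVneq => // zh; exfalso; move: hz.
  by rewrite -zh opprD addrA subrr add0r normcN ltxx.
- move=> z zb; have zd := on_square_dist l0 zb; have /andP[zin _] := zb.
  rewrite /q; case: eqVneq => [zc|zc].
    by exfalso; move: zd; rewrite zc subrr normc0; lra.
  have [_ fz] := fH z (sqc z zin).
  have c0 : normc (c - c) <= 2 * l by rewrite subrr normc0; lra.
  have [_ fc] := fH c c0.
  rewrite normcM normcV ler_pM ?invr_ge0 ?normc_ge0//.
    by apply: le_trans (le_normcB _ _) _; lra.
  by rewrite lef_pV2 ?posrE//; exact: lt_le_trans zd.
Qed.

Lemma is_derive_eps (phi : R -> R) (t D : R) :
  (forall e : R, 0 < e -> exists2 r : R, 0 < r & forall s, `|s| < r ->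
     `|phi (t + s) - phi t - D * s| <= e * `|s|) -> is_derive t 1 phi D.
Proof.
move=> H.
have C : (fun s => s^-1 *: ((phi \o shift t) (s *: 1) - phi t)) @ 0^' --> D.
  apply/cvgrPdist_le => e e0; have [r r0 rH] := H _ e0.
  apply/nbhs_ballP; exists r => // s; rewrite /ball /= sub0r normrN => sr s0.
  rewrite /GRing.scale /= mulr1.
  have -> : D - s^-1 * (phi (s + t) - phi t) = - (phi (t + s) - phi t - D * s) / s.
    by rewrite (addrC s); field.
  by rewrite normrM normrN normfV ler_pdivrMr ?normr_gt0//; exact: rH.
apply: DeriveDef; first by apply/cvg_ex; exists D.
exact/cvg_lim.
Qed.

(** The mean value theorem for the real and imaginary parts along the segment. *)
Lemma lipschitz_of_deriv f (c h : R[i]) K :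
  (forall t : R, 0 <= t <= 1 -> exists2 d, cdiff f (c + t%:C * h) d & normc d <= K) ->
  normc (f (c + h) - f c) <= 2 * K * normc h.
Proof.
move=> H.
have main (F : R[i] -> R) : (forall z w, F (z - w) = F z - F w) ->
    (forall (s : R) z, F (s%:C * z) = s * F z) -> (forall z, `|F z| <= normc z) ->
    `|F (f (c + h) - f c)| <= K * normc h.
  move=> FB FZ Fle.
  have /choice[D HD] : forall t : R, exists d, 0 <= t <= 1 ->
      cdiff f (c + t%:C * h) d /\ normc d <= K.
    move=> t; case: (boolP (0 <= t <= 1)) => [/H[d]|_]; [by exists d|by exists 0].
  pose phi t := F (f (c + t%:C * h)).
  have dphi (t : R) : 0 <= t <= 1 -> is_derive t 1 phi (F (D t * h)).
    move=> /HD[fd _]; apply: is_derive_eps => e e0.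
    have nh : 0 < normc h + 1 by have := normc_ge0 h; lra.
    have en : 0 < e / (normc h + 1) by rewrite divr_gt0.
    have [r r0 rH] := fd _ en.
    exists (r / (normc h + 1)) => [|s]; first by rewrite divr_gt0.
    rewrite ltr_pdivlMr// => sr.
    have sh : normc (s%:C * h) <= `|s| * (normc h + 1).
      by rewrite normcM normcR ler_wpM2l//; lra.
    have := rH (s%:C * h) (le_lt_trans sh sr) => A.
    rewrite /phi.
    have -> : c + (t + s)%:C * h = c + t%:C * h + s%:C * h by rewrite rmorphD/=; ring.
    rewrite (mulrC _ s) -FZ -!FB.
    have -> : s%:C * (D t * h) = D t * (s%:C * h) by ring.
    apply: le_trans (Fle _) _; apply: le_trans A _.
    by rewrite mulrAC ler_pdivrMr// -mulrA ler_wpM2l// ltW.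
  have [x /andP[x0 x1] E] : exists2 x, 0 <= x <= 1 & phi 1 - phi 0 = F (D x * h) * (1 - 0).
    have [||x xI ->] := @MVT_segment R phi (fun t => F (D t * h)) 0 1 ler01.
    - by move=> x; rewrite in_itv /= => x01; apply: dphi; lra.
    - apply: continuous_in_subspaceT => x /set_mem/=; rewrite in_itv/= => x01.
      have [dx _] := dphi x x01.
      by apply: differentiable_continuous; apply/derivable1_diffP.
    by exists x => //; move: xI; rewrite in_itv.
  have -> : F (f (c + h) - f c) = phi 1 - phi 0.
    by rewrite /phi FB mul1r mul0r addr0.
  rewrite E subr0 mulr1; apply: le_trans (Fle _) _; rewrite normcM ler_wpM2r ?normc_ge0//.
  by have [] := HD x; first by rewrite x0.
apply: le_trans (normc_le_ReIm _) _.
have -> : 2 * K * normc h = K * normc h + K * normc h by ring.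
apply: lerD; apply: main.
- exact: ReB.
- by move=> s [x y] /=; ring.
- exact: le_Re.
- exact: ImB.
- by move=> s [x y] /=; ring.
- exact: le_Im.
Qed.

Lemma cauchy_lipschitz f (c h : R[i]) (r M : R) : 0 < r ->
  (forall z, normc (z - c) < r -> (exists d, cdiff f z d) /\ normc (f z) <= M) ->
  normc h <= r / 2 -> normc (f (c + h) - f c) <= 128 * M / r * normc h.
Proof.
move=> r0 fH hr.
have -> : 128 * M / r = 2 * (8 * M / (r / 8)) by field; rewrite gt_eqF.
apply: lipschitz_of_deriv => t t01.
have th : normc (t%:C * h) <= r / 2.
  rewrite normcM normcR; apply: le_trans hr.
  by rewrite ler_piMl ?normc_ge0// ler_norml; lra.
have [[d fd] _] : (exists d, cdiff f (c + t%:C * h) d) /\ normc (f (c + t%:C * h)) <= M.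
  by apply: fH; rewrite (addrC c) addrK; lra.
exists d => //; apply: cauchy_derivative_bound fd => //; first by lra.
move=> z zr; apply: fH.
have -> : z - c = z - (c + t%:C * h) + t%:C * h by ring.
by apply: le_lt_trans (le_normcD _ _) _; lra.
Qed.

End CauchyEstimate.

(** * Series of analytic functions *)

Section Csum.
Variable R : realType.
Implicit Types (a b : nat -> R[i]) (s t : R[i]) (K : R).

Definition is_csum a s := forall e : R, 0 < e -> exists N, forall n, (N <= n)%N ->
  normc (s - \sum_(j < n) a j) <= e.

Lemma half_pow_small (K e : R) : 0 < e -> exists N, forall n, (N <= n)%N -> K / 2 ^+ n <= e.
Proof.
move=> e0; have [N KN] := half_small `|K| e0; exists N => n Nn.
apply: le_trans (ltW KN); apply: le_trans (_ : `|K| / 2 ^+ n <= _).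
  by rewrite ler_wpM2r ?ler_norm// invr_ge0 exprn_ge0.
by rewrite ler_wpM2l// lef_pV2 ?posrE ?exprn_gt0// ler_weXn2l// ler1n.
Qed.

Lemma csum_unique a s t : is_csum a s -> is_csum a t -> s = t.
Proof.
move=> Hs Ht; apply/eqP; rewrite -subr_eq0 -normc_eq0 eq_le normc_ge0 andbT.
apply/ler_addgt0Pr => e e0; rewrite add0r; have e2 : 0 < e / 2 by lra.
have [N HN] := Hs _ e2; have [N' HN'] := Ht _ e2.
have := HN _ (leq_maxl N N'); have := HN' _ (leq_maxr N N').
set S := \sum_(_ < _) _ => h1 h2.
have -> : s - t = (s - S) - (t - S) by ring.
by apply: le_trans (le_normcB _ _) _; lra.
Qed.

Lemma csum_lin a b s t (k : R[i]) : is_csum a s -> is_csum b t ->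
  is_csum (fun j => a j + k * b j) (s + k * t).
Proof.
move=> Hs Ht e e0; have k0 : 0 < normc k + 1 by have := normc_ge0 k; lra.
have e2 : 0 < e / 2 by lra.
have e3 : 0 < e / 2 / (normc k + 1) by rewrite divr_gt0.
have [N HN] := Hs _ e2; have [N' HN'] := Ht _ e3.
exists (maxn N N') => n; rewrite geq_max => /andP[/HN h1 /HN' h2].
rewrite big_split/= -mulr_sumr.
set A := \sum_(_ < _) _ in h1 *; set B := \sum_(_ < _) _ in h2 *.
have -> : s + k * t - (A + k * B) = (s - A) + k * (t - B) by ring.
apply: le_trans (le_normcD _ _) _; rewrite normcM.
have : normc k * normc (t - B) <= (normc k + 1) * (e / 2 / (normc k + 1)).
  by apply: ler_pM; rewrite ?normc_ge0//; lra.
have -> : (normc k + 1) * (e / 2 / (normc k + 1)) = e / 2 by field; rewrite gt_eqF.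
by lra.
Qed.

Lemma real_sum_ex (u : nat -> R) K : 0 <= K -> (forall j, `|u j| <= K / 2 ^+ j) ->
  exists x : R, forall J, `|x - \sum_(j < J) u j| <= 2 * K / 2 ^+ J.
Proof.
move=> K0 uK.
have h n : K / 2 ^+ n = 2 * (K / 2 ^+ n.+1) by rewrite exprS; field; rewrite expf_neq0.
have [|n|s Hs] := @nested_half R (fun n => \sum_(j < n) u j - 2 * K / 2 ^+ n) (4 * K).
- by lra.
- rewrite big_ord_recr/=; have := uK n; rewrite ler_norml.
  have := h n; rewrite -!mulrA; lra.
- exists s => J; have := Hs J; rewrite ler_norml -!mulrA; lra.
Qed.

(** A bound of the form K / 2^j, instead of absolute convergence, keeps explicit
tails: they are used both for uniformity and for the gliding hump. *)
Lemma csum_ex a K : (forall j, normc (a j) <= K / 2 ^+ j) ->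
  exists2 s, is_csum a s & forall J, normc (s - \sum_(j < J) a j) <= 4 * K / 2 ^+ J.
Proof.
move=> aK.
have K0 : 0 <= K by have := aK 0%N; rewrite expr0 divr1; apply: le_trans; exact: normc_ge0.
have [x Hx] := @real_sum_ex (fun j => Re (a j)) K K0 (fun j => le_trans (le_Re _) (aK j)).
have [y Hy] := @real_sum_ex (fun j => Im (a j)) K K0 (fun j => le_trans (le_Im _) (aK j)).
have main J : normc ((x +i* y) - \sum_(j < J) a j) <= 4 * K / 2 ^+ J.
  apply: le_trans (normc_le_ReIm _) _; rewrite ReB ImB /=.
  have -> : Re (\sum_(j < J) a j) = \sum_(j < J) Re (a j).
    by elim/big_rec2: _ => // i u v _ <-; rewrite ReD.
  have -> : Im (\sum_(j < J) a j) = \sum_(j < J) Im (a j).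
    by elim/big_rec2: _ => // i u v _ <-; rewrite ImD.
  have := Hx J; have := Hy J; rewrite -!mulrA; lra.
exists (x +i* y) => // e e0.
have [N HN] := half_pow_small (4 * K) e0.
by exists N => n /HN; exact: le_trans.
Qed.

Lemma csum_tail a s K : is_csum a s -> (forall j, normc (a j) <= K / 2 ^+ j) ->
  forall J, normc (s - \sum_(j < J) a j) <= 4 * K / 2 ^+ J.
Proof. by move=> Hs /csum_ex[t Ht]; rewrite (csum_unique Hs Ht). Qed.

Lemma csum_shift a s n : is_csum a s ->
  is_csum (fun j => a (n + j)%N) (s - \sum_(j < n) a j).
Proof.
move=> Hs e /Hs[N HN]; exists N => m Nm.
have := HN (n + m)%N (leq_trans Nm (leq_addl _ _)).
by rewrite big_split_ord/= opprD addrA.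
Qed.

Lemma cdiff_sumE (I : Type) (r : seq I) (F : I -> R[i] -> R[i]) (D : I -> R[i]) (z : R[i]) :
  (forall i, cdiff (F i) z (D i)) ->
  cdiff (fun x => \sum_(i <- r) F i x) z (\sum_(i <- r) D i).
Proof.
move=> HF; elim: r => [|i r IH].
  rewrite big_nil; have := cdiff_cst 0 z; apply: cdiff_eq; exists 1 => // h _.
  by rewrite big_nil.
rewrite big_cons; have := cdiffD (HF i) IH.
by apply: cdiff_eq; exists 1 => // h _; rewrite big_cons.
Qed.

(** Termwise differentiation: by the Cauchy estimates each term of the series has
difference quotients bounded by a multiple of 2^(-j), so for the derivative only
finitely many terms matter. *)
Lemma analytic_series (G : nat -> R[i] -> R[i]) :
  (forall j, analytic_disk (G j)) ->
  (forall r : R, r < 1 -> exists K, forall j z, normc z <= r -> normc (G j z) <= K / 2 ^+ j) ->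
  exists2 f, analytic_disk f & forall z, disk z -> is_csum (fun j => G j z) (f z).
Proof.
move=> Ga Gb.
have /choice[f Hf] : forall z, exists s, disk z -> is_csum (fun j => G j z) s.
  move=> z; case: (pselect (disk z)) => [dz|]; last by exists 0.
  have [K HK] := Gb _ dz.
  by have [|s Hs _] := @csum_ex (fun j => G j z) K; [move=> j; exact: HK|exists s].
exists f => // z dz; rewrite /disk /= in dz.
pose r := (1 - normc z) / 2; have r0 : 0 < r by rewrite /r; lra.
have rz1 : normc z + r < 1 by rewrite /r; lra.
have [K HK] := Gb _ rz1.
have K0 : 0 <= K.
  have := HK 0%N z; rewrite expr0 divr1 => H; apply: le_trans (normc_ge0 _) (H _); lra.
have inD w : normc (w - z) < r -> disk w.
  move=> wr; rewrite /disk /=; have := le_normcD (w - z) z; rewrite subrK; lra.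
have GD j w : normc (w - z) < r -> (exists d, cdiff (G j) w d) /\ normc (G j w) <= K / 2 ^+ j.
  move=> wr; split; first by apply: derivable_cdiff; apply: Ga; exact: inD.
  by apply: HK; have := le_normcD (w - z) z; rewrite subrK; lra.
(* the Lipschitz constant of [cauchy_lipschitz] on the disk of radius r about z *)
pose L := 128 * K / r.
have L0 : 0 <= L by rewrite /L divr_ge0 ?(ltW r0)// mulr_ge0.
have /choice[d Hd] j : exists d, cdiff (G j) z d.
  by have [] := GD j z; first by rewrite subrr normc0.
have dL j : normc (d j) <= L / 2 ^+ j.
  have r4 : 0 < r / 4 by lra.
  have := @cauchy_derivative_bound _ (G j) z (d j) (r / 4) (K / 2 ^+ j) r4 _ (Hd j).
  move=> H; apply: le_trans (H _) _; first by move=> w wr; apply: GD; lra.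
  have -> : L / 2 ^+ j = 4 * (8 * (K / 2 ^+ j) / (r / 4)).
    by rewrite /L; field; rewrite gt_eqF// expf_neq0.
  have : 0 <= 8 * (K / 2 ^+ j) / (r / 4).
    by rewrite divr_ge0 ?(ltW r4)// mulr_ge0// divr_ge0// exprn_ge0.
  by lra.
have [D HD _] := csum_ex dL.
apply: (@cdiff_derivable _ _ _ D) => e e0.
have e2 : 0 < e / 2 by lra.
have [N HN] := half_pow_small (8 * L) e2.
have {}HN := HN N (leqnn _).
have [t t0 tH] := cdiff_sumE (index_enum 'I_N) (fun j : 'I_N => Hd j) e2.
exists (Num.min t (r / 2)) => [|h]; first by rewrite lt_min t0; lra.
rewrite lt_min => /andP[ht hr].
have zh : normc (z + h - z) < r by rewrite (addrC z) addrK; lra.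
pose b j := G j (z + h) - G j z - d j * h.
have bs : is_csum b (f (z + h) - f z - D * h).
  have := csum_lin (-1) (csum_lin (-1) (Hf _ (inD _ zh)) (Hf _ dz)) (csum_lin (h - 1) HD HD).
  have -> : f (z + h) + -1 * f z + -1 * (D + (h - 1) * D) = f (z + h) - f z - D * h by ring.
  congr is_csum; apply/funext => j; rewrite /b; ring.
have bb j : normc (b j) <= 2 * L * normc h / 2 ^+ j.
  have A := @cauchy_lipschitz _ (G j) z h r (K / 2 ^+ j) r0 (GD j) (ltW hr).
  apply: le_trans (le_normcB _ _) _; rewrite normcM.
  have -> : 2 * L * normc h / 2 ^+ j = 128 * (K / 2 ^+ j) / r * normc h + L / 2 ^+ j * normc h.
    by rewrite /L; field; rewrite ?(gt_eqF r0) ?expf_neq0.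
  by apply: lerD => //; rewrite ler_wpM2r// normc_ge0.
have B := csum_tail bs bb N.
have C : normc (\sum_(j < N) b j) <= e / 2 * normc h.
  have := tH h ht; congr (normc _ <= _).
  by rewrite -sumrB mulr_suml -sumrB.
rewrite -[X in normc X](subrK (\sum_(j < N) b j)).
apply: le_trans (le_normcD _ _) _.
have : 4 * (2 * L * normc h) / 2 ^+ N <= e / 2 * normc h.
  have -> : 4 * (2 * L * normc h) / 2 ^+ N = (8 * L / 2 ^+ N) * normc h by ring.
  by rewrite ler_wpM2r// normc_ge0.
by lra.
Qed.

End Csum.

(** * The interpolation constant *)

Section Analytic.
Variable R : realType.
Implicit Types f g : R[i] -> R[i].

Lemma analyticP f : analytic_disk f <-> forall z, disk z -> exists d, cdiff f z d.
Proof.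
split=> H z /H; first exact: derivable_cdiff.
by move=> [d]; exact: cdiff_derivable.
Qed.

Lemma analytic_lin f g (k : R[i]) : analytic_disk f -> analytic_disk g ->
  analytic_disk (fun z => k * (f z - g z)).
Proof.
move=> /analyticP Hf /analyticP Hg; apply/analyticP => z dz.
have [d Hd] := Hf z dz; have [d' Hd'] := Hg z dz.
by eexists; apply: cdiffZ; apply: cdiffB; eassumption.
Qed.

Lemma analyticM f g : analytic_disk f -> analytic_disk g ->
  analytic_disk (fun z => f z * g z).
Proof.
move=> /analyticP Hf /analyticP Hg; apply/analyticP => z dz.
have [d Hd] := Hf z dz; have [d' Hd'] := Hg z dz.
by eexists; apply: cdiffM; eassumption.
Qed.

Lemma analyticZ f (k : R[i]) : analytic_disk f -> analytic_disk (fun z => k * f z).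
Proof.
move=> /analyticP Hf; apply/analyticP => z dz; have [d Hd] := Hf z dz.
by eexists; apply: cdiffZ; eassumption.
Qed.

Lemma analytic_sum (I : Type) (r : seq I) (F : I -> R[i] -> R[i]) :
  (forall i, analytic_disk (F i)) -> analytic_disk (fun z => \sum_(i <- r) F i z).
Proof.
move=> HF; apply/analyticP => z dz.
have /choice[D HD] i : exists d, cdiff (F i) z d by have /analyticP := HF i; apply.
by eexists; apply: cdiff_sumE; eassumption.
Qed.

Definition hinfty_le f (M : R) := analytic_disk f /\ forall z, disk z -> normc (f z) <= M.

End Analytic.

Section OpenMapping.
Variables (R : realType) (z : nat -> R[i]).
Hypothesis hz : forall n, disk (z n).
Hypothesis zint : interpolating_Hinfty z.

Lemma disk0 : @disk R 0. Proof. by rewrite /disk /mkset normc0. Qed.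

(** Gliding hump. If for every m some c_m in the unit ball could not be approximated
within 1/2 by the values of functions of norm at most m, take x = sum_J 16^(-J)
c_(m_J), where m_J is chosen so large, compared with the norm of a function
interpolating the J-th partial sum, that a function of norm N <= J
interpolating x would, after subtraction of the former and division by
16^(-J), be one of the excluded approximations of c_(m_J). *)
Lemma approx_interpolation : exists m : R, forall c : nat -> R[i],
  (forall n, normc (c n) <= 1) ->
  exists f, hinfty_le f m /\ forall n, normc (f (z n) - c n) <= 2^-1.
Proof.
apply: contrapT => /forallNP H.
have {H}/choice[cc Hcc] (m : R) : exists c : nat -> R[i], (forall n, normc (c n) <= 1) /\
    forall f, hinfty_le f m -> exists n, 2^-1 < normc (f (z n) - c n).
  have /existsNP[c /not_implyP[c1 /forallNP cf]] := H m; exists c; split=> // f fm.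
  apply: contrapT => /forallNP nf; apply: (cf f); split=> // n.
  by rewrite leNgt; apply/negP; exact: nf.
have /choice[G HG] (s : nat -> R[i]) : exists gN : (R[i] -> R[i]) * R,
    (exists M : R, forall n, normc (s n) <= M) ->
    [/\ 0 <= gN.2, hinfty_le gN.1 gN.2 & forall n, gN.1 (z n) = s n].
  case: (pselect (exists M : R, forall n, normc (s n) <= M)) => [sM|]; last by exists (id, 0).
  have [f [fa [N fN]] fs] := zint sM; exists (f, N) => _; split=> //=.
  exact: le_trans (normc_ge0 _) (fN _ disk0).
pose q J : R := (16 ^+ J)^-1.
have q0 J : 0 < q J by rewrite invr_gt0 exprn_gt0.
(* G s is a function interpolating s together with a bound on its norm *)
pose m J s : R := (q J)^-1 * (J%:R + (G s).2).
pose s := fix s J : nat -> R[i] :=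
  if J is J'.+1 then fun n => s J' n + (q J')%:C * cc (m J' (s J')) n else fun=> 0.
pose a n J := (q J)%:C * cc (m J (s J)) n.
have sE J n : s J n = \sum_(j < J) a n j.
  by elim: J => [|J IH]; [rewrite big_ord0|rewrite big_ord_recr/= IH].
have aq n J : normc (a n J) <= q J.
  rewrite normcM normcR (ger0_norm (ltW (q0 J))) ler_piMr// ?(ltW (q0 J))//.
  by have [] := Hcc (m J (s J)).
have q2 J : q J <= 1 / 2 ^+ J.
  by rewrite div1r /q lef_pV2 ?posrE ?exprn_gt0// lerXn2r ?nnegrE//; lra.
have a2 n J : normc (a n J) <= 1 / 2 ^+ J := le_trans (aq n J) (q2 J).
have /choice[x Hx] n : exists x, is_csum (a n) x.
  by have [x] := csum_ex (a2 n); exists x.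
have xs J n : normc (x n - s J n) <= 4 * 1 / 2 ^+ J.
  by rewrite sE; exact: csum_tail.
have [f [fa [N fN]] fx] : exists2 f, Hinfty f & forall n, f (z n) = x n.
  apply: zint; exists 4 => n; have := xs 0%N n.
  by rewrite /= subr0 expr0 divr1 mulr1.
have sb J : exists M : R, forall n, normc (s J n) <= M.
  exists 8 => n; have h1 := xs J n; have h2 := xs 0%N n.
  rewrite /= subr0 expr0 divr1 mulr1 in h2.
  have -> : s J n = x n - (x n - s J n) by ring.
  apply: le_trans (le_normcB _ _) _.
  have : 4 * 1 / 2 ^+ J <= 4 :> R.
    by rewrite mulr1 ler_pdivrMr ?exprn_gt0// ler_peMr// exprn_ege1// ler1n.
  by lra.
have N0 : 0 <= N := le_trans (normc_ge0 _) (fN _ disk0).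
pose J := Num.bound N; have NJ : N <= J%:R by exact: ltW (archi_boundP N0).
have [G0 [Ga Gb] Gs] := HG (s J) (sb J).
have [_ /(_ (fun w => (q J)^-1%:C * (f w - (G (s J)).1 w)))[|n]] := Hcc (m J (s J)).
  split; first exact: analytic_lin.
  move=> w dw; rewrite normcM normcR ger0_norm ?invr_ge0 ?(ltW (q0 J))//.
  rewrite /m ler_wpM2l ?invr_ge0 ?(ltW (q0 J))//.
  by apply: le_trans (le_normcB _ _) _; apply: lerD; [exact: le_trans (fN _ dw) NJ|exact: Gb].
rewrite fx Gs ltNge => /negP; apply.
have qC : (q J)^-1%:C * (q J)%:C = 1 :> R[i].
  by rewrite -rmorphM mulVf ?gt_eqF.
have -> : (q J)^-1%:C * (x n - s J n) - cc (m J (s J)) n = (q J)^-1%:C * (x n - s J.+1 n).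
  have -> : s J.+1 n = s J n + (q J)%:C * cc (m J (s J)) n by [].
  rewrite -[X in _ - X](mul1r (cc _ _)) -qC.
  by move: (_%:C) (_%:C) => A B; ring.
(* the later humps are too small to matter *)
have T : normc (x n - s J.+1 n) <= 4 * (q J.+1).
  have Hs := csum_shift J.+1 (Hx n).
  have Hb j : normc (a n (J.+1 + j)%N) <= q J.+1 / 2 ^+ j.
    apply: le_trans (aq n _) _; rewrite {1}/q exprD invfM -/(q _).
    rewrite ler_wpM2l ?(ltW (q0 _))// lef_pV2 ?posrE ?exprn_gt0//.
    by rewrite lerXn2r ?nnegrE//; lra.
  by have := csum_tail Hs Hb 0%N; rewrite big_ord0 subr0 expr0 divr1 -sE.
rewrite normcM normcR ger0_norm ?invr_ge0 ?(ltW (q0 J))//.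
rewrite mulrC ler_pdivrMr//; apply: le_trans T _.
have -> : q J.+1 = q J / 16 by rewrite /q exprSr invfM.
by have := q0 J; lra.
Qed.

(** Successive approximation: the error left by [approx_interpolation] is doubled
and approximated again. *)
Lemma bounded_interpolation : exists2 M : R, 0 <= M & forall c : nat -> R[i],
  (forall n, normc (c n) <= 1) ->
  exists f, hinfty_le f M /\ forall n, f (z n) = c n.
Proof.
have [m Hm] := approx_interpolation.
have m0 : 0 <= m.
  have [n|f [[_ fm] _]] := Hm (fun=> 0); first by rewrite normc0.
  exact: le_trans (normc_ge0 _) (fm _ disk0).
exists (4 * m) => [|c c1]; first by rewrite mulr_ge0.
have /choice[F HF] (s : nat -> R[i]) : exists f, (forall n, normc (s n) <= 1) ->
    hinfty_le f m /\ forall n, normc (f (z n) - s n) <= 2^-1.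
  by case: (pselect (forall n, normc (s n) <= 1)) => [/Hm[f]|]; [exists f|exists id].
pose s := fix s k : nat -> R[i] :=
  if k is k'.+1 then fun n => 2%:R%:C * (s k' n - F (s k') (z n)) else c.
have s1 k n : normc (s k n) <= 1.
  elim: k n => [//|k IH] n /=; have [_ /(_ n)] := HF (s k) IH.
  by rewrite normcM normcR normcB ger0_norm//; lra.
have h0 j : (0 : R) < (2 ^+ j)^-1 by rewrite invr_gt0 exprn_gt0.
pose g j w := (2 ^+ j)^-1%:C * F (s j) w.
have gb j w : disk w -> normc (g j w) <= m / 2 ^+ j.
  move=> dw; rewrite /g normcM normcR ger0_norm ?(ltW (h0 j))// mulrC.
  rewrite ler_wpM2r ?(ltW (h0 j))//.
  by have [[_ Fb] _] := HF _ (s1 j); exact: Fb.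
have [|r r1|f fa fs] := analytic_series (G := g).
- by move=> j; apply: analyticZ; have [[]] := HF _ (s1 j).
- by exists m => j w wr; apply: gb; rewrite /disk /=; exact: le_lt_trans wr r1.
exists f; split; first split=> // w dw.
  have := csum_tail (fs w dw) (fun j => gb j w dw) 0%N.
  by rewrite big_ord0 subr0 expr0 divr1.
move=> n; apply: csum_unique (fs _ (hz n)) _ => e e0.
have [N HN] := half_pow_small 1 e0; exists N => J /HN HJ.
have -> : c n - \sum_(j < J) g j (z n) = (2 ^+ J)^-1%:C * s J n.
  elim: {HJ} J => [|J IH]; first by rewrite big_ord0 subr0 expr0 invr1 mul1r.
  rewrite big_ord_recr/= opprD addrA IH /g -mulrBr mulrA; congr (_ * _).
  by rewrite -rmorphM; congr (_%:C); rewrite exprS invfM mulrC mulrA divff// mul1r.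
rewrite normcM normcR ger0_norm ?(ltW (h0 J))//; apply: le_trans HJ.
by rewrite div1r ler_piMr// ltW.
Qed.

End OpenMapping.

(** * Beurling functions *)

Section Signs.
Variables (R : realType) (N : nat).
Local Notation E := {ffun 'I_N -> bool}.
Local Notation n := (#|{: E}|%:R : R).
Implicit Types (e : E) (k l : 'I_N) (v : E -> R).

Definition rademacher e k : R := (-1) ^+ (e k).

Lemma card_signs_gt0 : 0 < n.
Proof. by rewrite ltr0n card_ffun expn_gt0 card_bool. Qed.

(** For k <> l, flipping the k-th sign changes the sign of every summand. *)
Lemma rademacher_orthogonal k l : \sum_e rademacher e k * rademacher e l = if k == l then n else 0.
Proof.
case: eqVneq => [<-|kl].
  under eq_bigr => e _ do rewrite /rademacher -signr_addb addbb expr0.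
  by rewrite sumr_const.
pose flip e : E := [ffun i => if i == k then ~~ e i else e i].
have flipK : involutive flip.
  by move=> e; apply/ffunP => i; rewrite !ffunE; case: eqP => //; rewrite negbK.
have H : \sum_e rademacher e k * rademacher e l = - \sum_e rademacher e k * rademacher e l.
  rewrite [LHS](reindex_inj (inv_inj flipK)) -sumrN; apply: eq_bigr => e _.
  rewrite /rademacher !ffunE eqxx eq_sym (negbTE kl).
  by case: (e k); rewrite /= ?expr0 ?expr1 ?mulNr ?mul1r ?opprK.
by lra.
Qed.

(** The mean over all signs e of (v e - sum_k b_k e_k)^2 is nonnegative, and by
orthogonality equals the difference of the two sides. *)
Lemma rademacher_bessel v (b := fun k => n^-1 * \sum_e rademacher e k * v e) :
  \sum_k b k ^+ 2 <= n^-1 * \sum_e v e ^+ 2.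
Proof.
have n0 := card_signs_gt0.
have nb k : \sum_e rademacher e k * v e = n * b k.
  by rewrite /b mulVKf ?gt_eqF.
have : 0 <= \sum_e (v e - \sum_k rademacher e k * b k) ^+ 2.
  by apply: sumr_ge0 => e _; exact: sqr_ge0.
have -> : \sum_e (v e - \sum_k rademacher e k * b k) ^+ 2 =
    \sum_e v e ^+ 2 - n * \sum_k b k ^+ 2.
  have -> : \sum_e (v e - \sum_k rademacher e k * b k) ^+ 2 = \sum_e v e ^+ 2 -
      (\sum_e v e * \sum_k rademacher e k * b k) *+ 2 + \sum_e (\sum_k rademacher e k * b k) ^+ 2.
    by rewrite -sumrMnl -sumrB -big_split/=; apply: eq_bigr => e _; rewrite sqrrB.
  have -> : \sum_e v e * \sum_k rademacher e k * b k = n * \sum_k b k ^+ 2.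
    under eq_bigr => e _ do rewrite mulr_sumr.
    rewrite exchange_big/= mulr_sumr; apply: eq_bigr => k _.
    rewrite expr2 mulrA -nb mulr_suml; apply: eq_bigr => e _; ring.
  have -> : \sum_e (\sum_k rademacher e k * b k) ^+ 2 = n * \sum_k b k ^+ 2.
    under eq_bigr => e _ do rewrite expr2 mulr_suml.
    rewrite exchange_big/= mulr_sumr; apply: eq_bigr => k _.
    under eq_bigr => e _ do rewrite mulr_sumr.
    rewrite exchange_big/= (bigD1 k)//= [X in _ + X]big1 ?addr0.
      have -> : \sum_e rademacher e k * b k * (rademacher e k * b k) = (\sum_e rademacher e k * rademacher e k) * b k ^+ 2.
        by rewrite mulr_suml; apply: eq_bigr => e _; ring.
      by rewrite rademacher_orthogonal eqxx.
    move=> l lk.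
    have -> : \sum_e rademacher e k * b k * (rademacher e l * b l) = (\sum_e rademacher e k * rademacher e l) * (b k * b l).
      by rewrite mulr_suml; apply: eq_bigr => e _; ring.
    by rewrite rademacher_orthogonal eq_sym (negbTE lk) mul0r.
  by rewrite mulr2n; lra.
by move=> H; rewrite [leRHS]mulrC ler_pdivlMr//; lra.
Qed.

End Signs.

Section Beurling.
Variables (R : realType) (z : nat -> R[i]).
Hypothesis hz : forall n, disk (z n).
Hypothesis zint : interpolating_Hinfty z.

Lemma ReZ (s : R) (u : R[i]) : Re (s%:C * u) = s * Re u.
Proof. by case: u => x y /=; ring. Qed.

Lemma ImZ (s : R) (u : R[i]) : Im (s%:C * u) = s * Im u.
Proof. by case: u => x y /=; ring. Qed.

Lemma normc_sqr (w : R[i]) : normc w ^+ 2 = Re w ^+ 2 + Im w ^+ 2.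
Proof. by case: w => a b /=; rewrite sqr_sqrtr// addr_ge0// sqr_ge0. Qed.

(** The functions are squares of the averages G_k of (sign k) times f_e over all
choices of signs e, where f_e interpolates the signs on the block
lo <= k < lo + N and 0 elsewhere. Squaring keeps the values 0 and 1 and turns
the l^2 bound into the l^1 bound. *)
Lemma beurling_functions : exists2 Q : R, 0 <= Q & forall lo N : nat, exists F : nat -> R[i] -> R[i],
  [/\ forall k, analytic_disk (F k),
      forall k l, (lo <= k < lo + N)%N -> F k (z l) = (l == k)%:R &
      forall w, disk w -> \sum_(lo <= k < lo + N) normc (F k w) <= Q].
Proof.
have [M M0 HM] := bounded_interpolation hz zint.
exists (M ^+ 2) => [|lo N]; first exact: sqr_ge0.
pose E := {ffun 'I_N -> bool}.
pose n : R := #|{: E}|%:R.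
have n0 : 0 < n by exact: card_signs_gt0.
have /choice[f Hf] (e : E) : exists f, hinfty_le f M /\
    forall l, f (z l) = \sum_(k < N) (l == (lo + k)%N)%:R * (rademacher R e k)%:C.
  apply: HM => l; have [lN|lN] := boolP (lo <= l < lo + N)%N; last first.
    rewrite big1 ?normc0// => k _; case: eqP => [lk|_]; last by rewrite mul0r.
    by exfalso; move: lN; rewrite lk leq_addr ltn_add2l ltn_ord.
  have ls : (l - lo < N)%N by move/andP: lN => [a1 a2]; rewrite ltn_subLR.
  have llo : (lo + (l - lo))%N = l by move/andP: lN => [a1 _]; rewrite subnKC.
  rewrite (bigD1 (Ordinal ls))//= llo eqxx mul1r big1 ?addr0.
    by rewrite normcR /rademacher normr_sign.
  move=> k; rewrite -(inj_eq val_inj)/= => kl; case: eqP => [lk|_]; last by rewrite mul0r.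
  by exfalso; move: kl; rewrite lk addKn eqxx.
pose G (k : 'I_N) w := n^-1%:C * \sum_e (rademacher R e k)%:C * f e w.
have Ga k : analytic_disk (G k).
  apply: analyticZ; apply: analytic_sum => e; apply: analyticZ.
  by have [[]] := Hf e.
have Gz k l : G k (z l) = (l == (lo + k)%N)%:R.
  rewrite /G.
  have -> : \sum_e (rademacher R e k)%:C * f e (z l) =
      \sum_(k' < N) (l == (lo + k')%N)%:R * (\sum_e rademacher R e k * rademacher R e k')%:C.
    under eq_bigr => e _ do rewrite (proj2 (Hf e)) mulr_sumr.
    rewrite exchange_big/=; apply: eq_bigr => k' _.
    rewrite rmorph_sum/= mulr_sumr; apply: eq_bigr => e _.
    by rewrite rmorphM/= mulrCA.
  rewrite (bigD1 k)//= [X in _ + X]big1; last first.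
    by move=> k' kk'; rewrite rademacher_orthogonal (eq_sym k) (negbTE kk') mulr0.
  rewrite rademacher_orthogonal eqxx addr0 mulrCA -rmorphM/= mulVf ?(gt_eqF n0)//.
  by rewrite rmorph1 mulr1.
have Gb w : disk w -> \sum_k normc (G k w) ^+ 2 <= M ^+ 2.
  move=> dw.
  have ReG (i : 'I_N) : Re (G i w) = n^-1 * \sum_e rademacher R e i * Re (f e w).
    rewrite /G ReZ; congr (_ * _).
    by elim/big_rec2: _ => // e u v _ <-; rewrite ReD ReZ.
  have ImG (i : 'I_N) : Im (G i w) = n^-1 * \sum_e rademacher R e i * Im (f e w).
    rewrite /G ImZ; congr (_ * _).
    by elim/big_rec2: _ => // e u v _ <-; rewrite ImD ImZ.
  under eq_bigr => i _ do rewrite normc_sqr ReG ImG.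
  rewrite big_split/=; apply: le_trans (lerD (rademacher_bessel _) (rademacher_bessel _)) _.
  rewrite -mulrDr -big_split/= -/n mulrC ler_pdivrMr//.
  have -> : M ^+ 2 * n = \sum_(e : E) M ^+ 2 by rewrite sumr_const mulr_natr.
  apply: ler_sum => e _; rewrite -normc_sqr lerXn2r ?nnegrE ?normc_ge0//.
  by have [[_ H] _] := Hf e; exact: H.
pose F (k : nat) (w : R[i]) : R[i] :=
  if insub (k - lo)%N is Some i then G i w * G i w else 0.
exists F; split.
- move=> k; rewrite /F; case: insubP => [i _ _|_]; first exact: analyticM.
  by apply/analyticP => w _; exists 0; exact: cdiff_cst.
- move=> k l /andP[k1 k2]; rewrite /F insubT ?ltn_subLR// => ks.
  rewrite !Gz/= subnKC//; by case: eqP => _; rewrite ?mulr1 ?mulr0.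
- move=> w dw; rewrite -{1}[lo]add0n big_addn addKn big_mkord.
  apply: le_trans (Gb w dw); rewrite le_eqVlt; apply/orP; left; apply/eqP.
  apply: eq_bigr => k _; rewrite /F addnK insubT// => ks.
  rewrite -normcX expr2; congr (normc (G _ _ * G _ _)); exact: val_inj.
Qed.

End Beurling.

(** * Comparison of values of a normal weight *)

Section Weight.
Variables (R : realType).
Implicit Types (x y r s t : R).

Lemma powR_div x y c : 0 <= x -> 0 <= y -> (x / y) `^ c = x `^ c / y `^ c.
Proof.
move=> x0 y0; rewrite powRM ?invr_ge0//; congr (_ * _).
by rewrite -powR_inv1// powRAC powR_inv1 ?powR_ge0.
Qed.

Lemma le0_ler_powR x y c : c <= 0 -> 0 < x -> x <= y -> y `^ c <= x `^ c.
Proof.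
move=> c0 x0 xy; rewrite -[c]opprK !(powRN _ (- c)).
rewrite lef_pV2 ?posrE ?powR_gt0//; last exact: lt_le_trans xy.
by apply: ge0_ler_powR; rewrite ?oppr_ge0 ?nnegrE//; lra.
Qed.

(** Near the circle the two monotonicity conditions give the two powers, one for
each order of r and s; away from it w is bounded above and below. Lowering the
exponent of the decreasing condition and raising the exponent of the increasing
one keeps the monotonicity, which permits b < 0 and an integer A. *)
Lemma weight_compare (w : R -> R) : normal_function w -> ((-1)%:E < b_index w)%E ->
  exists C b (A : nat), [/\ 0 < C, -1 < b < 0 & forall r s, 0 <= r < 1 -> 0 <= s < 1 ->
    w r <= C * w s * (((1 - r) / (1 - s)) ^+ A + ((1 - r) / (1 - s)) `^ b)].
Proof.
move=> [w0 _ wb [a [b2 [r0 [r01 [[winc _] _]]]]]] hb.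
have [b1 [b1N [rb rb01 [wdec _]]]] : exists b1, -1 < b1 /\
    exists2 rb : R, 0 < rb < 1 & quot_decreases_to_zero w b1 rb.
  apply: contrapT => /forallNP H; move: hb; rewrite ltNge => /negP; apply.
  rewrite /b_index; apply: ge_ereal_sup => _ [b1 Hb1 <-]; rewrite lee_fin leNgt.
  by apply/negP => b1N; apply: (H b1).
pose b := Num.min b1 (- 2^-1).
have bb1 : b <= b1 by rewrite ge_min lexx.
have bN : b <= - 2^-1 by rewrite ge_min lexx orbT.
have b1' : -1 < b by rewrite lt_min b1N; lra.
pose A := Num.bound `|a|.
have aA : a <= A%:R by apply: le_trans (ler_norm a) _; apply: ltW; exact: archi_boundP.
pose q := (Num.max r0 rb + 1) / 2.
have [q0 q1 qr0 qrb] : [/\ 0 < q, q < 1, r0 < q & rb < q].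
  have : r0 <= Num.max r0 rb by rewrite le_max lexx.
  have : rb <= Num.max r0 rb by rewrite le_max lexx orbT.
  have : Num.max r0 rb < 1 by rewrite gt_max; lra.
  by rewrite /q; split; lra.
have D s t : q <= s -> s <= t -> t < 1 -> w t <= w s * ((1 - t) / (1 - s)) `^ b.
  move=> qs st t1; have s1 : s < 1 := le_lt_trans st t1.
  have ws : 0 < w s by apply: w0; lra.
  have : w t / (1 - t) `^ b1 <= w s / (1 - s) `^ b1.
    by apply: wdec => //; rewrite in_itv/=; lra.
  rewrite ler_pdivrMr ?powR_gt0//; last by lra.
  move=> H; apply: le_trans H _; rewrite mulrAC -mulrA -powR_div; [|lra|lra].
  rewrite ler_pM2l//; apply: ger_powR => //.
  by rewrite divr_gt0 ?ler_pdivrMr; lra.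
have I s t : q <= s -> s <= t -> t < 1 -> w s <= w t * ((1 - s) / (1 - t)) ^+ A.
  move=> qs st t1; have s1 : s < 1 := le_lt_trans st t1.
  have wt : 0 < w t by apply: w0; lra.
  have : w s / (1 - s) `^ a <= w t / (1 - t) `^ a.
    by apply: winc => //; rewrite in_itv/=; lra.
  rewrite ler_pdivrMr ?powR_gt0//; last by lra.
  move=> H; apply: le_trans H _; rewrite mulrAC -mulrA -powR_div; [|lra|lra].
  rewrite ler_pM2l// -powR_mulrn; last by rewrite divr_ge0; lra.
  by apply: ler_powR => //; rewrite ler_pdivlMr; lra.
have [m [Mx [m0 wmM]]] := wb q (introT andP (conj (ltW q0) q1)).
have mM : m <= Mx by have := wmM 0; rewrite lexx (ltW q0) => /(_ isT) /andP[]; exact: le_trans.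
have wm t : 0 <= t -> t < q -> m <= w t by move=> t0 tq; have /andP[] : m <= w t <= Mx by apply: wmM; rewrite t0 ltW.
have wM t : 0 <= t -> t < q -> w t <= Mx by move=> t0 tq; have /andP[] : m <= w t <= Mx by apply: wmM; rewrite t0 ltW.
have [wqm wqM] : m <= w q /\ w q <= Mx by have := wmM q; rewrite lexx (ltW q0) => /(_ isT) /andP.
exists (Mx / m), b, A; split; [by rewrite divr_gt0//; lra|by rewrite b1'; lra|].
move=> r s r01' s01; have [s0 _] := andP s01; have [r0' _] := andP r01'; have wr := w0 _ r01'; have ws := w0 _ s01.
have C1 : 1 <= Mx / m by rewrite ler_pdivlMr// mul1r.
set u := (1 - r) / (1 - s); have u0 : 0 < u by rewrite divr_gt0; lra.
have uA : 0 <= u ^+ A by rewrite exprn_ge0 ?ltW.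
have ub := powR_ge0 u b.
have step v : 0 <= v -> w s * v <= Mx / m * w s * v.
  by move=> v0; rewrite ler_wpM2r// ler_peMl// ltW.
have Mm v : m <= v -> Mx <= Mx / m * v by move=> mv; rewrite -ler_pdivrMl ?divr_gt0 ?invf_div ?divfK ?gt_eqF//; lra.
have split2 X : X <= Mx / m * w s * u ^+ A \/ X <= Mx / m * w s * u `^ b ->
    X <= Mx / m * w s * (u ^+ A + u `^ b).
  have ? : 0 <= Mx / m * w s by rewrite mulr_ge0 ?(ltW ws)//; lra.
  by rewrite mulrDr => -[]; move/le_trans; apply; rewrite ?lerDl ?lerDr mulr_ge0.
case: (leP q s) => qs; case: (leP q r) => qr; apply: split2.
- case: (leP s r) => sr.
    by right; apply: le_trans (D _ _ qs sr _) (step _ _) => //; lra.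
  by left; apply: le_trans (I _ _ qr (ltW sr) _) (step _ _) => //; lra.
- left; apply: (@le_trans _ _ Mx).
    exact: wM.
  apply: le_trans (Mm _ wqm) _; rewrite -[leRHS]mulrA ler_wpM2l//; first by lra.
  apply: le_trans (I q s (lexx _) qs _) _; first by lra.
  rewrite ler_wpM2l ?(ltW ws)// lerXn2r ?nnegrE ?divr_ge0//; try by lra.
  by rewrite ler_pM2r ?invr_gt0; lra.
- right; apply: le_trans (D q r (lexx _) qr _) _; first by lra.
  have qr0' : 0 < (1 - r) / (1 - q) by rewrite divr_gt0; lra.
  apply: ler_pM; rewrite ?powR_ge0//; first by lra.
    apply: le_trans wqM _; apply: Mm.
    exact: wm.
  apply: le0_ler_powR => //; first by lra.
  by rewrite ler_pM2l ?lef_pV2 ?posrE; lra.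
- have wMm : w r <= Mx / m * w s.
    apply: (@le_trans _ _ Mx); first exact: wM.
    by apply: Mm; exact: wm.
  case: (leP 1 u) => u1.
    left; apply: le_trans wMm _; rewrite ler_peMr ?exprn_ege1//.
    by rewrite mulr_ge0 ?(ltW ws)//; lra.
  right; apply: le_trans wMm _; rewrite ler_peMr//.
    by rewrite mulr_ge0 ?(ltW ws)//; lra.
  rewrite -[leLHS](powRr0 u); apply: ger_powR; last by lra.
  by rewrite u0 ltW.
Qed.

End Weight.

(** * One-dimensional integrals *)

Section Integrals.
Variable R : realType.
Notation mu := (@lebesgue_measure R).

Import HBNNSimple.
(** The integral of a nonnegative function is a supremum over the simple functions
below it, so it is monotone for arbitrary functions; here f involves the weight,
which is only Lebesgue measurable. *)
Lemma le_integral_nonmeas d (T : measurableType d) (m : {measure set T -> \bar R})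
  (D : set T) (f g : T -> \bar R) :
  (forall x, D x -> (0 <= f x)%E) -> (forall x, (0 <= g x)%E) ->
  (forall x, D x -> (f x <= g x)%E) ->
  (\int[m]_(x in D) f x <= \int[m]_x g x)%E.
Proof.
move=> f0 g0 fg; rewrite (ge0_integralE _ f0) (ge0_integralTE _ g0).
apply: ereal_sup_le => _ [h hf <-]; exists h => // x.
apply: le_trans (hf x) _; rewrite /patch; case: ifPn => [|_//].
by rewrite inE => /fg.
Qed.

Lemma geom_series_le (B q : R) : 0 <= B -> 0 <= q < 1 ->
  (\sum_(k <oo) (B * q ^+ k)%:E <= (B / (1 - q))%:E)%E.
Proof.
move=> B0 /andP[q0 q1]; apply: lime_le.
  by apply: is_cvg_nneseries => n _ _; rewrite lee_fin mulr_ge0// exprn_ge0.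
apply: nearW => n; rewrite sumEFin lee_fin big_mkord -mulr_sumr ler_wpM2l//.
rewrite -[leRHS]mul1r ler_pdivlMr ?subr_gt0// mulrC.
have := subrX1 q n; rewrite -[_ ^+ n - 1]opprB -[q - 1]opprB mulNr => /oppr_inj <-.
by rewrite lerBlDr lerDl exprn_ge0.
Qed.

(** A function bounded by c_k on I_k, where the sets I_k cover its support, is at
most the sum of the multiples c_k of their indicators. With dyadic I_k this
replaces the computation of antiderivatives. *)
Lemma integral_le_series d (T : measurableType d) (m : {measure set T -> \bar R})
  (f : T -> R) (I : nat -> set T) (c : nat -> R) (B q : R) :
  (forall x, 0 <= f x) -> (forall k, measurable (I k)) -> (forall k, 0 <= c k) ->
  0 <= B -> 0 <= q < 1 ->
  (forall k, ((c k)%:E * m (I k) <= (B * q ^+ k)%:E)%E) ->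
  (forall x, 0 < f x -> exists2 k, I k x & f x <= c k) ->
  (\int[m]_x (f x)%:E <= (B / (1 - q))%:E)%E.
Proof.
move=> f0 mI c0 B0 q01 cB fI.
apply: (@le_trans _ _ (\int[m]_x (\sum_(k <oo) (c k * \1_(I k) x)%:E))%E).
  apply: le_integral_nonmeas => [x _|x|x _].
  - by rewrite lee_fin.
  - by apply: nneseries_ge0 => k _ _; rewrite lee_fin mulr_ge0.
  - have [fx|/fI[k Ik fk]] := leP (f x) 0.
      apply: (@le_trans _ _ 0%E); first by rewrite lee_fin.
      by apply: nneseries_ge0 => k _ _; rewrite lee_fin mulr_ge0.
    rewrite (nneseries_split 0 k.+1); last by move=> j _; rewrite lee_fin mulr_ge0.
    rewrite add0n big_nat_recr//= -addeA addeC.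
    apply: le_trans (_ : ((c k * \1_(I k) x)%:E <= _)%E).
      by rewrite lee_fin indicE mem_set// mulr1.
    rewrite -addeA leeDl// adde_ge0//.
      by apply: nneseries_ge0 => j _ _; rewrite lee_fin mulr_ge0.
    by apply: sume_ge0 => j _; rewrite lee_fin mulr_ge0.
rewrite integral_nneseries//; last 2 first.
- by move=> k; apply/measurable_EFinP; apply: measurable_funM => //.
- by move=> k x _; rewrite lee_fin mulr_ge0.
apply: le_trans (geom_series_le B0 q01); apply: lee_nneseries => k _.
  by rewrite integral_ge0// => x _; rewrite lee_fin mulr_ge0.
under eq_integral do rewrite EFinM.
rewrite ge0_integralZl//=; last 2 first.
- by apply/measurable_EFinP.
- by rewrite lee_fin.
by rewrite integral_indic// setIT.
Qed.

Definition lorentz (xi de x : R) : R := (1 + ((x - xi) / de) ^+ 2)^-1.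

(** The singular part of t^b for b < 0: for t >= 1 the power is at most 1, and the points
outside the disk correspond to t <= 0. *)
Definition edge_power (b t : R) : R := t `^ b * \1_(`]0, 1[%classic : set R) t.

Lemma lorentz_gt0 xi de x : 0 < lorentz xi de x.
Proof. by rewrite invr_gt0 ltr_pwDl// sqr_ge0. Qed.

Lemma lorentz_le1 xi de x : lorentz xi de x <= 1.
Proof. by rewrite invf_le1 ?lerDl ?sqr_ge0// ltr_pwDl// sqr_ge0. Qed.

Lemma edge_power_ge0 b t : 0 <= edge_power b t.
Proof. by rewrite mulr_ge0// powR_ge0. Qed.

Lemma lebesgue_measure_cc (a b : R) : a < b -> mu `[a, b]%classic = (b - a)%:E.
Proof. by move=> ab; rewrite lebesgue_measure_itv/= lte_fin ab EFinB. Qed.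

Lemma integral_lorentz xi de : 0 < de -> (\int[mu]_x (lorentz xi de x)%:E <= (16 * de)%:E)%E.
Proof.
move=> de0.
have -> : 16 * de = 8 * de / (1 - 2^-1) by field.
apply: (@integral_le_series _ _ mu (lorentz xi de)
  (fun k => `[xi - 2 ^+ k * de, xi + 2 ^+ k * de]%classic) (fun k => 4 / 4 ^+ k)) => //.
- by move=> x; exact/ltW/lorentz_gt0.
- by rewrite mulr_ge0// ltW.
- by apply/andP; split; lra.
- move=> k; have h0 : 0 < 2 ^+ k * de by rewrite mulr_gt0// exprn_gt0.
  rewrite /= lebesgue_measure_cc; last by lra.
  rewrite -EFinM lee_fin le_eqVlt; apply/orP; left; apply/eqP.
  have -> : (4 : R) ^+ k = 2 ^+ k * 2 ^+ k by rewrite -exprMn; congr (_ ^+ _); lra.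
  by rewrite exprVn; field; rewrite expf_neq0.
- move=> x _; set t := `|x - xi| / de.
  have t0 : 0 <= t by rewrite divr_ge0// ltW.
  have phit : lorentz xi de x = (1 + t ^+ 2)^-1.
    by rewrite /lorentz /t !exprMn -normrX ger0_norm ?sqr_ge0.
  have exk : exists k, t <= 2 ^+ k.
    exists (Num.bound t); apply: le_trans (ltW (archi_boundP t0)) _.
    by rewrite -natrX ler_nat ltnW// ltn_expl.
  have [k tk kmin] := ex_minnP exk.
  exists k.
    rewrite /= in_itv/=; move: tk; rewrite /t ler_pdivrMr// ler_norml.
    by lra.
  rewrite phit; case: k tk kmin => [|k] tk kmin.
    by rewrite expr0 divr1; apply: (@le_trans _ _ 1); [rewrite -phit lorentz_le1|lra].
  have kt : 2 ^+ k < t.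
    by rewrite ltNge; apply/negP => /kmin; rewrite ltnn.
  have -> : 4 / 4 ^+ k.+1 = ((2 ^+ k) ^+ 2)^-1 :> R.
    by rewrite exprS -exprM mulnC exprM; have -> : (2 : R) ^+ 2 = 4 by [lra]; field; rewrite expf_neq0.
  rewrite lef_pV2 ?posrE ?exprn_gt0//; last by rewrite ltr_pwDl// sqr_ge0.
  apply: (@le_trans _ _ (t ^+ 2)); last by rewrite lerDr.
  by rewrite lerXn2r ?nnegrE// ?exprn_ge0// ltW.
Qed.

(** On the two intervals of points x with rho - |x| between de / 2^(k+1) and
de / 2^k the integrand is at most a multiple of 2^(-b k); the products with the
lengths are summable because 1 + b > 0. *)
Lemma integral_edge_power b : -1 < b < 0 -> exists2 K : R, 0 < K & forall rho de : R, 0 < de ->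
  (\int[mu]_x (edge_power b ((rho - `|x|) / de))%:E <= (K * de)%:E)%E.
Proof.
move=> b01; pose q : R := 2^-1 `^ (1 + b).
have h2 : 0 < (2^-1 : R) by lra.
have q0 : 0 < q by exact: powR_gt0.
have q1 : q < 1.
  have := @gt0_ltr_powR R (1 + b) _ 2^-1 1; rewrite powR1 => -> //; rewrite ?nnegrE; lra.
exists (4 / (1 - q)); first by rewrite divr_gt0//; lra.
move=> rho de de0.
have -> : 4 / (1 - q) * de = 4 * de / (1 - q) by ring.
pose e k : R := 2^-1 ^+ k * de.
have e0 k : 0 < e k by rewrite mulr_gt0// exprn_gt0.
apply: (@integral_le_series _ _ mu (fun x => edge_power b ((rho - `|x|) / de))
  (fun k => (`[rho - e k, rho] `|` `[- rho, - rho + e k])%classic)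
  (fun k => (2^-1 ^+ k.+1) `^ b)) => //.
- by move=> x; exact: edge_power_ge0.
- by move=> k; apply: measurableU.
- by rewrite mulr_ge0// ltW.
- by rewrite (ltW q0).
- move=> k.
  apply: (@le_trans _ _ (((2^-1 ^+ k.+1) `^ b)%:E * (2 * e k)%:E)%E).
    rewrite lee_wpmul2l ?lee_fin ?powR_ge0//.
    pose I1 := `[rho - e k, rho]%classic; pose I2 := `[- rho, - rho + e k]%classic.
    apply: (@le_trans _ _ (mu I1 + mu I2)%E).
      by apply: measureU2; exact: measurable_itv.
    have ek := e0 k; rewrite /I1 /I2 !lebesgue_measure_cc; [|by lra..].
    by rewrite -EFinD lee_fin; lra.
  rewrite -EFinM lee_fin.
  have -> : (2^-1 ^+ k.+1) `^ b = 2^-1 `^ b * (2^-1 `^ b) ^+ k :> R.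
    rewrite -!powR_mulrn ?powR_ge0 ?(ltW h2)// -!powRrM -powRD ?(gt_eqF h2) ?implybT//.
    by congr (_ `^ _); rewrite -natr1; ring.
  have -> : q ^+ k = 2^-1 ^+ k * (2^-1 `^ b) ^+ k.
    by rewrite -exprMn /q powRD ?powRr1 ?(gt_eqF h2) ?implybT// ltW.
  have hb : 2^-1 `^ b <= 2 :> R.
    have := @ger_powR R 2^-1 _ (-1) b; rewrite powR_inv1 ?invrK ?(ltW h2)// => -> //; lra.
  have P : 0 <= (2^-1 `^ b) ^+ k * e k by rewrite mulr_ge0 ?exprn_ge0 ?powR_ge0// ltW.
  move: P hb; rewrite /e; set Y := _ ^+ k; set Z := _ ^+ k => P hb.
  have -> : 4 * de * (Z * Y) = 2 * (2 * (Y * (Z * de))) by ring.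
  have -> : 2^-1 `^ b * Y * (2 * (Z * de)) = 2 * (2^-1 `^ b * (Y * (Z * de))) by ring.
  by rewrite ler_pM2l// ler_wpM2r.
- move=> x; set v := (rho - `|x|) / de; rewrite /edge_power indicE.
  case: (boolP (v \in _)) => [|_]; last by rewrite mulr0 ltxx.
  rewrite inE/= in_itv/= => /andP[v0 v1] _; rewrite mulr1.
  have exk : exists k, 2^-1 ^+ k.+1 < v.
    have [k Hk] := half_small 1 v0; exists k; apply: lt_trans Hk.
    by rewrite div1r exprVn ltf_pV2 ?posrE ?exprn_gt0// exprS ltr_pMl ?exprn_gt0// ltr1n.
  have [k kv kmin] := ex_minnP exk.
  have vk : v <= 2^-1 ^+ k.
    case: k kv kmin => [|k] kv kmin; first by rewrite expr0 ltW.
    by rewrite leNgt; apply/negP => /kmin; rewrite ltnn.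
  exists k.
    have A : rho - `|x| <= e k by move: vk; rewrite /v ler_pdivrMr.
    have B : 0 < rho - `|x| by move: v0; rewrite /v pmulr_lgt0// invr_gt0.
    rewrite /= !in_itv/=; have [x0|x0] := leP 0 x.
      by left; move: A B; rewrite ger0_norm//; lra.
    by right; move: A B; rewrite ltr0_norm//; lra.
  by apply: le0_ler_powR; rewrite ?exprn_gt0//; [lra|exact: ltW].
Qed.

End Integrals.

(** * Integrals over the plane *)

Section ProductIntegral.
Variable R : realType.
Notation mu := (@lebesgue_measure R).

Lemma prod_integral1 (f : R -> R) (g : R * R -> R) (A B : R) :
  (forall x, 0 <= f x) -> (forall u, 0 <= g u) -> 0 <= A ->
  measurable_fun setT f -> measurable_fun setT g ->
  (forall x, (\int[mu]_y (g (x, y))%:E <= A%:E)%E) ->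
  (\int[mu]_x (f x)%:E <= B%:E)%E ->
  (\int[mu \x mu]_u (f u.1 * g u)%:E <= (A * B)%:E)%E.
Proof.
move=> f0 g0 A0 mf mg gA fB.
rewrite fubini_tonelli1/=; last 2 first.
- apply/measurable_EFinP; apply: measurable_funM => //.
  by apply: measurableT_comp => //; exact: measurable_fst.
- by move=> u; rewrite lee_fin mulr_ge0.
rewrite /fubini_F /=.
apply: (@le_trans _ _ (\int[mu]_x (A * f x)%:E)%E).
  apply: le_integral_nonmeas => [x _|x|x _].
  - by apply: integral_ge0 => y _; rewrite lee_fin mulr_ge0.
  - by rewrite lee_fin mulr_ge0.
  - under eq_integral do rewrite EFinM.
    rewrite ge0_integralZl//=; last 3 first.
    + by apply/measurable_EFinP; apply: measurableT_comp => //; exact: measurable_pair1.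
    + by move=> y _; rewrite lee_fin.
    + by rewrite lee_fin.
    by rewrite mulrC EFinM lee_wpmul2l// lee_fin.
under eq_integral do rewrite EFinM.
rewrite ge0_integralZl//=; last 2 first.
- exact/measurable_EFinP.
- by move=> y _; rewrite lee_fin.
by rewrite EFinM lee_wpmul2l// lee_fin.
Qed.

Lemma prod_integral2 (f : R -> R) (g : R * R -> R) (A B : R) :
  (forall x, 0 <= f x) -> (forall u, 0 <= g u) -> 0 <= A ->
  measurable_fun setT f -> measurable_fun setT g ->
  (forall y, (\int[mu]_x (g (x, y))%:E <= A%:E)%E) ->
  (\int[mu]_x (f x)%:E <= B%:E)%E ->
  (\int[mu \x mu]_u (f u.2 * g u)%:E <= (A * B)%:E)%E.
Proof.
move=> f0 g0 A0 mf mg gA fB.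
rewrite fubini_tonelli2/=; last 2 first.
- apply/measurable_EFinP; apply: measurable_funM => //.
  by apply: measurableT_comp => //; exact: measurable_snd.
- by move=> u; rewrite lee_fin mulr_ge0.
rewrite /fubini_G /=.
apply: (@le_trans _ _ (\int[mu]_x (A * f x)%:E)%E).
  apply: le_integral_nonmeas => [x _|x|x _].
  - by apply: integral_ge0 => y _; rewrite lee_fin mulr_ge0.
  - by rewrite lee_fin mulr_ge0.
  - under eq_integral do rewrite EFinM.
    rewrite ge0_integralZl//=; last 3 first.
    + by apply/measurable_EFinP; apply: measurableT_comp => //; exact: measurable_pair2.
    + by move=> y _; rewrite lee_fin.
    + by rewrite lee_fin.
    by rewrite mulrC EFinM lee_wpmul2l// lee_fin.
under eq_integral do rewrite EFinM.
rewrite ge0_integralZl//=; last 2 first.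
- exact/measurable_EFinP.
- by move=> y _; rewrite lee_fin.
by rewrite EFinM lee_wpmul2l// lee_fin.
Qed.

Lemma measurable_lorentz xi de : measurable_fun setT (@lorentz R xi de).
Proof.
rewrite (_ : lorentz xi de = fun x => (1 + ((x - xi) / de) ^+ 2) `^ (-1)).
  apply: (measurableT_comp (measurable_powR (-1))).
  apply: measurable_funD => //; apply: measurable_funX.
  by apply: measurable_funM => //; exact: measurable_funB.
by apply/funext => x; rewrite powR_inv1// addr_ge0// sqr_ge0.
Qed.

Lemma measurable_edge_power b : measurable_fun setT (@edge_power R b).
Proof. by apply: measurable_funM => //; exact: measurable_powR. Qed.

(** In the horizontal slice at height u.2 the disk ends at |u.1| = sqrt(1 - u.2^2). *)
Definition edge_strip1 b de (u : R * R) : R := edge_power b ((Num.sqrt (1 - u.2 ^+ 2) - `|u.1|) / de).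
Definition edge_strip2 b de (u : R * R) : R := edge_power b ((Num.sqrt (1 - u.1 ^+ 2) - `|u.2|) / de).

Lemma measurable_sqrt1 : measurable_fun setT (fun x : R => Num.sqrt (1 - x ^+ 2)).
Proof.
apply: continuous_measurable_fun => x.
apply: (@continuous_comp _ _ _ (fun x : R => 1 - x ^+ 2) Num.sqrt); last exact: sqrt_continuous.
by apply: cvgB; [exact: cvg_cst|exact: exprn_continuous].
Qed.

Lemma measurable_edge_strip1 b de : measurable_fun setT (edge_strip1 b de).
Proof.
apply: (measurableT_comp (measurable_edge_power b)).
apply: measurable_funM => //; apply: measurable_funB.
  by apply: (measurableT_comp measurable_sqrt1); exact: measurable_snd.
by apply: measurableT_comp => //; exact: measurable_fst.
Qed.

Lemma measurable_edge_strip2 b de : measurable_fun setT (edge_strip2 b de).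
Proof.
apply: (measurableT_comp (measurable_edge_power b)).
apply: measurable_funM => //; apply: measurable_funB.
  by apply: (measurableT_comp measurable_sqrt1); exact: measurable_fst.
by apply: measurableT_comp => //; exact: measurable_snd.
Qed.

(** The singular terms keep only the decay transversal to the slice in which their
singularity is integrated. *)
Definition majorant b (zeta : R[i]) (de : R) (u : R * R) : R :=
  lorentz (Re zeta) de u.1 * lorentz (Im zeta) de u.2 +
  (lorentz (Im zeta) de u.2 * edge_strip1 b de u + lorentz (Re zeta) de u.1 * edge_strip2 b de u).

Lemma lorentz_ge0 xi de x : 0 <= @lorentz R xi de x.
Proof. exact/ltW/lorentz_gt0. Qed.

Lemma majorant_ge0 b zeta de u : 0 <= majorant b zeta de u.
Proof. by rewrite !addr_ge0// mulr_ge0 ?lorentz_ge0 ?edge_power_ge0. Qed.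

Lemma measurable_lorentz1 xi de : measurable_fun setT (fun u : R * R => lorentz xi de u.1).
Proof. by apply: (measurableT_comp (measurable_lorentz xi de)); exact: measurable_fst. Qed.

Lemma measurable_lorentz2 xi de : measurable_fun setT (fun u : R * R => lorentz xi de u.2).
Proof. by apply: (measurableT_comp (measurable_lorentz xi de)); exact: measurable_snd. Qed.

Lemma measurable_majorant b zeta de : measurable_fun setT (majorant b zeta de).
Proof.
apply: measurable_funD; last apply: measurable_funD; apply: measurable_funM;
  by [exact: measurable_lorentz1|exact: measurable_lorentz2|exact: measurable_edge_strip1|exact: measurable_edge_strip2].
Qed.

Lemma integral_majorant b : -1 < b < 0 -> exists2 K : R, 0 < K & forall zeta de, 0 < de ->
  (\int[mu \x mu]_u (majorant b zeta de u)%:E <= (K * de ^+ 2)%:E)%E.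
Proof.
move=> /integral_edge_power[K K0 HK]; exists (256 + 32 * K); first by lra.
move=> zeta de de0.
have -> : (256 + 32 * K) * de ^+ 2 =
  16 * de * (16 * de) + (K * de * (16 * de) + K * de * (16 * de)) by ring.
have d16 : 0 <= 16 * de by lra.
have dK : 0 <= K * de by rewrite mulr_ge0// ltW.
under eq_integral do rewrite /majorant !EFinD.
rewrite ge0_integralD//=; last 4 first.
- by move=> u _; rewrite lee_fin mulr_ge0 ?lorentz_ge0.
- by apply/measurable_EFinP; apply: measurable_funM; [exact: measurable_lorentz1|exact: measurable_lorentz2].
- by move=> u _; rewrite -EFinD lee_fin addr_ge0// mulr_ge0 ?lorentz_ge0 ?edge_power_ge0.
- under eq_fun do rewrite -EFinD.
  apply/measurable_EFinP; apply: measurable_funD; apply: measurable_funM;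
  by [exact: measurable_lorentz1|exact: measurable_lorentz2|exact: measurable_edge_strip1|exact: measurable_edge_strip2].
rewrite ge0_integralD//=; last 4 first.
- by move=> u _; rewrite lee_fin mulr_ge0 ?lorentz_ge0 ?edge_power_ge0.
- by apply/measurable_EFinP; apply: measurable_funM; [exact: measurable_lorentz2|exact: measurable_edge_strip1].
- by move=> u _; rewrite lee_fin mulr_ge0 ?lorentz_ge0 ?edge_power_ge0.
- by apply/measurable_EFinP; apply: measurable_funM; [exact: measurable_lorentz1|exact: measurable_edge_strip2].
rewrite EFinD leeD//; last first.
  rewrite EFinD leeD//.
    apply: (@prod_integral2 (lorentz (Im zeta) de) (edge_strip1 b de)) => //.
    - exact: lorentz_ge0.
    - by move=> u; exact: edge_power_ge0.
    - exact: measurable_lorentz.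
    - exact: measurable_edge_strip1.
    - by move=> y; rewrite /edge_strip1 /=; exact: (HK (Num.sqrt (1 - y ^+ 2)) de de0).
    - exact: integral_lorentz.
  apply: (@prod_integral1 (lorentz (Re zeta) de) (edge_strip2 b de)) => //.
  - exact: lorentz_ge0.
  - by move=> u; exact: edge_power_ge0.
  - exact: measurable_lorentz.
  - exact: measurable_edge_strip2.
  - by move=> y; rewrite /edge_strip2 /=; exact: (HK (Num.sqrt (1 - y ^+ 2)) de de0).
  - exact: integral_lorentz.
apply: (@prod_integral1 (lorentz (Re zeta) de) (fun u => lorentz (Im zeta) de u.2)) => //.
- exact: lorentz_ge0.
- by move=> u; exact: lorentz_ge0.
- exact: measurable_lorentz.
- exact: measurable_lorentz2.
- by move=> y; exact: integral_lorentz.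
- exact: integral_lorentz.
Qed.

End ProductIntegral.

(** * The peaking kernels *)

Section Kernel.
Variable R : realType.
Implicit Types (zeta z : R[i]) (b de : R).

(** The s-th power of the reproducing kernel of H^2 at zeta, normalized to be 1 at
zeta. *)
Definition peak s zeta z : R[i] := ((1 - normc zeta ^+ 2)%:C / (1 - conjc zeta * z)) ^+ s.

Lemma normc_conj zeta : normc (conjc zeta) = normc zeta.
Proof. by case: zeta => a b /=; rewrite sqrrN. Qed.

(** The last two bounds come from
|1 - conj(zeta) z|^2 - |z - zeta|^2 = (1 - |zeta|^2) (1 - |z|^2). *)
Lemma peak_den_ge zeta z : disk zeta -> disk z ->
  [/\ 1 - normc zeta <= normc (1 - conjc zeta * z), 1 - normc z <= normc (1 - conjc zeta * z),
      `|Re z - Re zeta| <= normc (1 - conjc zeta * z) &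
      `|Im z - Im zeta| <= normc (1 - conjc zeta * z)].
Proof.
rewrite /disk /mkset => z1 z2.
have n1 := normc_ge0 zeta; have n2 := normc_ge0 z.
have A : 1 - normc zeta * normc z <= normc (1 - conjc zeta * z).
  by have := le_normc_sub 1 (conjc zeta * z); rewrite normcM normc_conj normc1.
have B : normc (z - zeta) <= normc (1 - conjc zeta * z).
  rewrite -(@ler_pXn2r _ 2) ?nnegrE ?normc_ge0// -subr_ge0.
  have -> : normc (1 - conjc zeta * z) ^+ 2 - normc (z - zeta) ^+ 2 =
      (1 - normc zeta ^+ 2) * (1 - normc z ^+ 2).
    rewrite !normc_sqr; case: zeta z {z1 z2 n1 n2 A} => a c [x y] /=.
    by ring.
  by apply: mulr_ge0; nra.
split; [nra|nra| |].
- by apply: le_trans B; rewrite -ReB; exact: le_Re.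
- by apply: le_trans B; rewrite -ImB; exact: le_Im.
Qed.

(** If (Im z)^2 <= 1/2 then rho = sqrt(1 - (Im z)^2) is at least 1/2 and
1 - |z| >= (rho^2 - (Re z)^2) / 2 >= (rho - |Re z|) / 4; otherwise the same
holds with the two coordinates exchanged. *)
Lemma disk_edge_strip b de (z : R[i]) : -1 < b < 0 -> 0 < de -> disk z ->
  ((1 - normc z) / de) `^ b <=
    4 + 4 * edge_strip1 b de (Re z, Im z) + 4 * edge_strip2 b de (Re z, Im z).
Proof.
move=> b01 de0; rewrite /disk /mkset => z1.
have nz := normc_ge0 z.
have key (x y : R) : x ^+ 2 + y ^+ 2 = normc z ^+ 2 -> y ^+ 2 <= 2^-1 ->
    ((1 - normc z) / de) `^ b <= 4 + 4 * edge_power b ((Num.sqrt (1 - y ^+ 2) - `|x|) / de).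
  move=> xy y2; set rho := Num.sqrt _.
  have rho2 : rho ^+ 2 = 1 - y ^+ 2 by rewrite sqr_sqrtr//; lra.
  have rho0 : 0 <= rho := sqrtr_ge0 _.
  have rhoh : 2^-1 <= rho by nra.
  have x2 : `|x| ^+ 2 = x ^+ 2 by rewrite real_normK// num_real.
  have x0 := normr_ge0 x.
  have xrho : `|x| < rho by rewrite -(@ltr_pXn2r _ 2) ?nnegrE//; nra.
  have d1 : (rho - `|x|) / 4 <= 1 - normc z by nra.
  set v := (rho - `|x|) / de.
  have v0 : 0 < v by rewrite divr_gt0// subr_gt0.
  have uv : v / 4 <= (1 - normc z) / de.
    by rewrite /v mulrAC ler_pM2r// invr_gt0.
  apply: (@le_trans _ _ ((v / 4) `^ b)).
    by apply: le0_ler_powR => //; [lra|rewrite divr_gt0].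
  have h4 : (v / 4) `^ b <= 4 * v `^ b.
    rewrite powR_div ?(ltW v0)// mulrC ler_wpM2r ?powR_ge0//.
    rewrite -powRN -[leRHS]powRr1//; apply: ler_powR; lra.
  apply: le_trans h4 _.
  have [v1|v1] := ltP v 1.
    have -> : edge_power b v = v `^ b.
      by rewrite /edge_power indicE mem_set ?mulr1//= in_itv/= v0.
    by lra.
  have : v `^ b <= 1.
    by rewrite -[leRHS](powRr0 v); apply: ler_powR => //; lra.
  by have := edge_power_ge0 b v; lra.
have n2 : normc z ^+ 2 = Re z ^+ 2 + Im z ^+ 2 := normc_sqr z.
have n21 : normc z ^+ 2 < 1 by nra.
have p1 := edge_power_ge0 b ((Num.sqrt (1 - Im z ^+ 2) - `|Re z|) / de).
have p2 := edge_power_ge0 b ((Num.sqrt (1 - Re z ^+ 2) - `|Im z|) / de).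
rewrite /edge_strip1 /edge_strip2 /=; have [y2|y2] := leP (Im z ^+ 2) 2^-1.
  by have := key (Re z) (Im z) (esym n2) y2; lra.
have x2 : Re z ^+ 2 <= 2^-1 by lra.
have n2' : Im z ^+ 2 + Re z ^+ 2 = normc z ^+ 2 by rewrite n2 addrC.
by have := key (Im z) (Re z) n2' x2; lra.
Qed.

(** Let X = |1 - conj(zeta) z| / (1 - |zeta|) and u = (1 - |z|) / (1 - |zeta|).
Then X >= 1 and X >= u, so |peak|^p <= const X^(-A-4) beats u^A and leaves
X^(-4) (1 + u^b). Two factors X^(-2) give the decay in the two coordinates. *)
Lemma peak_weight (w : R -> R) C b (A s : nat) (p : R) : (forall r, 0 <= r < 1 -> 0 < w r) ->
  0 < C -> -1 < b < 0 -> 0 < p -> A%:R + 4 <= s%:R * p ->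
  (forall r s, 0 <= r < 1 -> 0 <= s < 1 ->
    w r <= C * w s * (((1 - r) / (1 - s)) ^+ A + ((1 - r) / (1 - s)) `^ b)) ->
  forall zeta z, disk zeta -> disk z ->
  normc (peak s zeta z) `^ p * w (normc z) <=
    2 `^ (s%:R * p) * C * 20 * (w (normc zeta) * majorant b zeta (1 - normc zeta) (Re z, Im z)).
Proof.
move=> w0 C0 b01 p0 sp wC zeta z dzeta dz.
have [g1 g2 g3 g4] := peak_den_ge dzeta dz.
have bs := disk_edge_strip b01 _ dz.
have n1 := normc_ge0 zeta; have n2 := normc_ge0 z.
have z1 : normc zeta < 1 := dzeta; have z2 : normc z < 1 := dz.
set de := 1 - normc zeta in g1 *; have de0 : 0 < de by rewrite /de; lra.
have {}bs := bs de de0.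
set N := normc (1 - conjc zeta * z) in g1 g2 g3 g4 *.
have N0 : 0 < N by lra.
set X := N / de; have X1 : 1 <= X by rewrite ler_pdivlMr// mul1r.
have X0 : 0 < X by lra.
have wz0 : 0 < w (normc zeta) by apply: w0; rewrite n1.
have kX : normc (peak s zeta z) `^ p <= 2 `^ (s%:R * p) * (X ^+ (A + 4))^-1.
  rewrite /peak normcX normcM normcV normcR -/N.
  have q0 : 0 <= 1 - normc zeta ^+ 2 by nra.
  rewrite ger0_norm// -powR_mulrn ?divr_ge0 ?(ltW N0)// -powRrM.
  apply: (@le_trans _ _ ((2 / X) `^ (s%:R * p))).
    have sp0 : 0 <= s%:R * p by rewrite mulr_ge0// ltW.
    have le2 : (1 - normc zeta ^+ 2) / N <= 2 / X.
      have -> : 2 / X = 2 * de / N by rewrite /X; field; rewrite !gt_eqF.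
      by rewrite ler_pM2r ?invr_gt0// /de; nra.
    by apply: ge0_ler_powR => //; rewrite nnegrE divr_ge0// ltW.
  rewrite powR_div ?(ltW X0)// ler_wpM2l ?powR_ge0//.
  rewrite lef_pV2 ?posrE ?powR_gt0 ?exprn_gt0//.
  by rewrite -powR_mulrn ?(ltW X0)//; apply: ler_powR => //; rewrite natrD.
have := wC (normc z) (normc zeta); rewrite n1 n2 => /(_ z2 z1); rewrite -/de.
set u := (1 - normc z) / de in bs * => wu.
have u0 : 0 < u by rewrite divr_gt0//; lra.
have uX : u <= X by rewrite ler_pM2r// invr_gt0.
have XA : 1 <= X ^+ A by rewrite exprn_ege1.
have uA : u ^+ A <= X ^+ A by rewrite lerXn2r ?nnegrE// ltW.
have ub := powR_ge0 u b.
set F1 := lorentz (Re zeta) de (Re z); set F2 := lorentz (Im zeta) de (Im z).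
have F10 : 0 < F1 by exact: lorentz_gt0.
have F20 : 0 < F2 by exact: lorentz_gt0.
have F11 : F1 <= 1 by exact: lorentz_le1.
have F21 : F2 <= 1 by exact: lorentz_le1.
have sq (t : R) : `|t| <= N -> (X ^+ 2)^-1 <= 2 * (1 + (t / de) ^+ 2)^-1.
  move=> tN; have t2 : (t / de) ^+ 2 <= X ^+ 2.
    rewrite -[leLHS]ger0_norm ?sqr_ge0// normrX lerXn2r ?nnegrE ?(ltW X0)//.
    by rewrite normrM normfV (gtr0_norm de0) ler_pM2r// invr_gt0.
  have X2 : 0 < X ^+ 2 by rewrite exprn_gt0.
  have t0 : 0 < 1 + (t / de) ^+ 2 by rewrite ltr_pwDl// sqr_ge0.
  rewrite ler_pdivlMr// mulrC ler_pdivrMr//.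
  have : 1 <= X ^+ 2 by rewrite exprn_ege1.
  by lra.
have X4 : (X ^+ 4)^-1 <= 4 * (F1 * F2).
  have -> : (X ^+ 4)^-1 = (X ^+ 2)^-1 * (X ^+ 2)^-1 by rewrite -invfM -exprD.
  have -> : 4 * (F1 * F2) = (2 * F1) * (2 * F2) by ring.
  have i0 : 0 <= (X ^+ 2)^-1 by rewrite invr_ge0 exprn_ge0// ltW.
  by apply: ler_pM => //; apply: sq.
have XX : (X ^+ (A + 4))^-1 * (u ^+ A + u `^ b) <= (X ^+ 4)^-1 * (1 + u `^ b).
  rewrite exprD invfM mulrAC mulrC ler_wpM2l ?invr_ge0 ?exprn_ge0 ?(ltW X0)//.
  rewrite mulrC ler_pdivrMr; last by lra.
  by nra.
set s1 := edge_strip1 b de (Re z, Im z) in bs *; set s2 := edge_strip2 b de (Re z, Im z) in bs *.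
have s10 : 0 <= s1 := edge_power_ge0 _ _.
have s20 : 0 <= s2 := edge_power_ge0 _ _.
have main : (X ^+ 4)^-1 * (1 + u `^ b) <= 20 * majorant b zeta de (Re z, Im z).
  rewrite /majorant /= -/F1 -/F2 -/s1 -/s2.
  apply: (@le_trans _ _ (4 * (F1 * F2) * (5 + 4 * s1 + 4 * s2))).
    apply: ler_pM => //; [by rewrite invr_ge0 exprn_ge0// ltW|lra|lra].
  have : F1 * F2 * s1 <= F2 * s1 by rewrite ler_wpM2r// ler_piMl// ltW.
  have : F1 * F2 * s2 <= F1 * s2 by rewrite ler_wpM2r// ler_piMr// ltW.
  have : 0 <= F2 * s1 by rewrite mulr_ge0// ltW.
  have : 0 <= F1 * s2 by rewrite mulr_ge0// ltW.
  by lra.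
apply: le_trans (ler_pM (powR_ge0 _ _) (ltW _) kX wu) _.
  by apply: w0; rewrite n2.
have -> : 2 `^ (s%:R * p) * (X ^+ (A + 4))^-1 * (C * w (normc zeta) * (u ^+ A + u `^ b)) =
  2 `^ (s%:R * p) * C * w (normc zeta) * ((X ^+ (A + 4))^-1 * (u ^+ A + u `^ b)) by ring.
have -> : 2 `^ (s%:R * p) * C * 20 * (w (normc zeta) * majorant b zeta de (Re z, Im z)) =
  2 `^ (s%:R * p) * C * w (normc zeta) * (20 * majorant b zeta de (Re z, Im z)) by ring.
apply: ler_wpM2l; last exact: le_trans XX main.
by rewrite !mulr_ge0 ?powR_ge0 ?ltW.
Qed.

End Kernel.

(** * Summable blocks and growth of the kernels *)

Section Assembly.
Variable R : realType.
Notation mu := (@lebesgue_measure R).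
Implicit Types (z zeta : R[i]).

(** Each block starts where the tail of the series has become smaller than the
required bound. *)
Lemma summable_blocks (T : nat -> R) (q : R) : (forall n, 0 <= T n) -> 0 < q ->
  (\sum_(0 <= n <oo) (T n)%:E < +oo)%E ->
  exists N : nat -> nat, exists2 S : R, 0 <= S & [/\ N 0%N = 0%N, forall j, (N j < N j.+1)%N &
    forall j, \sum_(N j <= k < N j.+1) T k <= S * q ^+ j].
Proof.
move=> T0 q0 Tfin.
pose P n := \sum_(0 <= k < n) T k.
have [S0 HS] : exists S0, forall n, P n <= S0.
  exists (fine (\sum_(0 <= n <oo) (T n)%:E)%E) => n; rewrite -lee_fin fineK.
    by rewrite /P -sumEFin; apply: nneseries_lim_ge => k _ _; rewrite lee_fin.
  by rewrite ge0_fin_numE//; apply: nneseries_ge0 => k _ _; rewrite lee_fin.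
have Pm n m : P (n + m)%N = P n + \sum_(n <= k < n + m) T k.
  by rewrite /P (@big_cat_nat _ _ _ n)//= leq_addr.
have hsup : has_sup (range P) by split; [exists (P 0%N); exists 0%N|exists S0 => _ [n _ <-]].
have /choice[h Hh] (e : R) : exists n, 0 < e -> forall m k, (n <= m)%N ->
    \sum_(m <= i < k) T i <= e.
  case: (pselect (0 < e)) => [e0|]; last by exists 0%N.
  have [_ [n _ <-] Pn] := sup_adherent e0 hsup.
  exists n => _ m k nm; have [mk|km] := leqP m k; last by rewrite big_geq ?ltW// ltnW.
  have := Pm m (k - m)%N; rewrite subnKC// => E.
  have := ub_le_sup hsup.2 (ex_intro2 _ _ k I erefl : range P (P k)).
  have : P n <= P m.
    by rewrite -(subnKC nm) Pm lerDl sumr_ge0.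
  by move: Pn; lra.
pose N := fix N j : nat := if j is j'.+1 then maxn (N j').+1 (h (q ^+ j'.+1)) else 0%N.
exists N, (1 + S0).
  by have := HS 0%N; rewrite /P big_geq//; lra.
have S00 : 0 <= S0 by have := HS 0%N; rewrite /P big_geq.
split=> // [j|j]; first by rewrite /= leq_maxl.
have qj : 0 < q ^+ j by rewrite exprn_gt0.
case: j qj => [|j] qj.
  rewrite expr0 mulr1 [X in \sum_(X <= _ < _) _]/=.
  by have := HS (N 1%N); rewrite /P; lra.
apply: le_trans (Hh _ qj _ _ _) _; first by rewrite /= leq_maxr.
by rewrite ler_peMl ?(ltW qj)//; lra.
Qed.

Lemma peak_diag s zeta : disk zeta -> peak s zeta zeta = 1.
Proof.
move=> dz; rewrite /peak; have n0 := normc_ge0 zeta.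
have z1 : normc zeta < 1 := dz.
have -> : 1 - conjc zeta * zeta = (1 - normc zeta ^+ 2)%:C.
  rewrite normc_sqr; case: zeta {dz n0 z1} => a b; apply/eqP; rewrite eq_complex /=.
  by apply/andP; split; apply/eqP; ring.
rewrite divff ?expr1n// -normc_gt0 normcR normr_gt0.
by rewrite gt_eqF//; nra.
Qed.

Lemma peak_analytic s zeta : disk zeta -> analytic_disk (peak s zeta).
Proof.
move=> dzeta; apply/analyticP => z dz; apply: cdiff_exp.
  apply: cdiffZ; apply: cdiffV; last first.
    by apply: cdiffB; [exact: cdiff_cst|apply: cdiffZ; exact: cdiff_id].
  have [g1 _ _ _] := peak_den_ge dzeta dz; rewrite -normc_gt0.
  by apply: lt_le_trans g1; have : normc zeta < 1 := dzeta; lra.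
Qed.

Definition bergman_weight (w : R -> R) (p : R) zeta : R :=
  (w (normc zeta) * (1 - normc zeta) ^+ 2) `^ p^-1.

(** Comparing w(0) with w(|zeta|) shows that w(|zeta|) is at least a multiple of
(1 - |zeta|)^A, and s is large enough for |peak| <= const (1 - |zeta|)^s to win.
This makes the series converge locally uniformly. *)
Lemma peak_growth (w : R -> R) C b (A s : nat) (p : R) : (forall r, 0 <= r < 1 -> 0 < w r) ->
  0 < C -> -1 < b < 0 -> 1 < p -> (A + 4 <= s)%N ->
  (forall r s, 0 <= r < 1 -> 0 <= s < 1 ->
    w r <= C * w s * (((1 - r) / (1 - s)) ^+ A + ((1 - r) / (1 - s)) `^ b)) ->
  forall r, r < 1 -> exists2 L, 0 <= L & forall zeta z, disk zeta -> normc z <= r ->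
    normc (peak s zeta z) <= L * bergman_weight w p zeta.
Proof.
move=> w0 C0 b01 p1 As wC r r1.
have w00 : 0 < w 0 by apply: w0; rewrite lexx ltr01.
pose c0 := w 0 / (2 * C); have c00 : 0 < c0 by rewrite divr_gt0// mulr_gt0.
pose L := (2 / (1 - r)) ^+ s / c0 `^ p^-1.
have pi0 : 0 < p^-1 by rewrite invr_gt0; lra.
have pi1 : p^-1 <= 1 by rewrite invf_le1; lra.
exists L => [|zeta z dzeta zr].
  by rewrite divr_ge0 ?powR_ge0// exprn_ge0// divr_ge0//; lra.
have z1 : normc zeta < 1 := dzeta; have n1 := normc_ge0 zeta.
have dz : disk z by rewrite /disk/mkset; lra.
have [_ g2 _ _] := peak_den_ge dzeta dz.
set de := 1 - normc zeta; have de0 : 0 < de by rewrite /de; lra.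
have de1 : de <= 1 by rewrite /de; lra.
have wz : c0 * de ^+ A <= w (normc zeta).
  have := wC 0 (normc zeta); rewrite lexx ltr01 n1 z1 subr0 -/de => /(_ isT isT).
  have i1 : 1 <= 1 / de by rewrite ler_pdivlMr// mul1r.
  have u1 : (1 / de) `^ b <= (1 / de) ^+ A.
    apply: (@le_trans _ _ 1); last by rewrite exprn_ege1.
    by rewrite -[leRHS](powRr0 (1 / de)); apply: ler_powR => //; lra.
  have wz0 : 0 < w (normc zeta) by apply: w0; rewrite n1.
  move=> H; have {H}: w 0 <= C * w (normc zeta) * (2 * (1 / de) ^+ A).
    apply: le_trans H _; rewrite ler_wpM2l ?mulr_ge0 ?(ltW C0) ?(ltW wz0)//; lra.
  have dA : 0 < de ^+ A by rewrite exprn_gt0.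
  rewrite div1r exprVn mulrA ler_pdivlMr// => H.
  rewrite /c0 mulrAC ler_pdivrMr ?mulr_gt0//; lra.
have om : c0 `^ p^-1 * de ^+ s <= bergman_weight w p zeta.
  rewrite /bergman_weight -/de; apply: (@le_trans _ _ ((c0 * de ^+ (A + 2)) `^ p^-1)); last first.
    apply: ge0_ler_powR; rewrite ?nnegrE ?(ltW pi0)//.
    - by rewrite mulr_ge0 ?(ltW c00)// exprn_ge0// ltW.
    - by rewrite mulr_ge0 ?sqr_ge0// ltW// w0// n1.
    - by rewrite exprD mulrA ler_wpM2r ?sqr_ge0.
  rewrite powRM ?(ltW c00) ?exprn_ge0 ?(ltW de0)// ler_wpM2l ?powR_ge0//.
  rewrite -!powR_mulrn ?(ltW de0)// -powRrM.
  apply: ger_powR; first by rewrite de0.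
  apply: (@le_trans _ _ (A + 2)%:R); first by rewrite ler_piMr.
  by rewrite ler_nat; apply: leq_trans As; rewrite leq_add2l.
rewrite /peak normcX normcM normcV normcR ger0_norm; last by nra.
apply: (@le_trans _ _ ((2 / (1 - r) * de) ^+ s)).
  have N0 : 0 < normc (1 - conjc zeta * z) by lra.
  have q0 : 0 <= 1 - normc zeta ^+ 2 by nra.
  rewrite lerXn2r ?nnegrE ?mulr_ge0 ?invr_ge0 ?(ltW de0) ?(ltW N0)//; try lra.
  rewrite mulrAC; apply: ler_pM => //; first by rewrite invr_ge0 ltW.
    by rewrite /de; nra.
  by rewrite lef_pV2 ?posrE//; lra.
rewrite exprMn /L -mulrA ler_wpM2l//.
  by rewrite exprn_ge0// divr_ge0//; lra.
by rewrite mulrC ler_pdivlMr ?powR_gt0// mulrC.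
Qed.

End Assembly.

(** * Interpolation in the weighted Bergman space *)

Section Final.
Variable R : realType.
Notation mu := (@lebesgue_measure R).

Lemma block_sum_le (m n : nat) (x y : nat -> R) (Q Y : R) : 0 <= Y ->
  (forall k, (m <= k < n)%N -> x k <= Y) -> (forall k, 0 <= y k) ->
  \sum_(m <= k < n) y k <= Q -> \sum_(m <= k < n) x k * y k <= Q * Y.
Proof.
move=> Y0 xY y0 yQ; apply: (@le_trans _ _ (\sum_(m <= k < n) Y * y k)).
  by apply: ler_sum_nat => k /xY xk; rewrite ler_wpM2r.
by rewrite -mulr_sumr mulrC ler_wpM2r.
Qed.

Lemma le_term_sum_nat (m n k : nat) (x : nat -> R) : (m <= k < n)%N ->
  (forall i, 0 <= x i) -> x k <= \sum_(m <= i < n) x i.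
Proof.
move=> /andP[mk kn] x0; rewrite (@big_cat_nat _ _ _ k)//=; last exact: ltnW.
by rewrite (big_ltn kn) addrCA lerDl addr_ge0// sumr_ge0.
Qed.

Lemma integral_majorant_block (m n : nat) (a de : nat -> R) (b K : R) (z : nat -> R[i]) :
  (forall k, 0 <= a k) -> (forall k, 0 < de k) ->
  (forall zeta de, 0 < de -> (\int[mu \x mu]_u (majorant b zeta de u)%:E <= (K * de ^+ 2)%:E)%E) ->
  (\int[mu \x mu]_u (\sum_(m <= k < n) a k / de k ^+ 2 * majorant b (z k) (de k) u)%:E
    <= (K * \sum_(m <= k < n) a k)%:E)%E.
Proof.
move=> a0 de0 HK.
have c0 k : 0 <= a k / de k ^+ 2 by rewrite divr_ge0// sqr_ge0.
under eq_integral do rewrite -sumEFin.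
rewrite ge0_integral_sum//; last 2 first.
- move=> k; apply/measurable_EFinP; apply: measurable_funM => //; exact: measurable_majorant.
- by move=> k u _; rewrite lee_fin mulr_ge0 ?majorant_ge0.
rewrite mulr_sumr -sumEFin; apply: lee_sum => k _.
under eq_integral do rewrite EFinM.
rewrite ge0_integralZl//=; last 3 first.
- by apply/measurable_EFinP; exact: measurable_majorant.
- by move=> u _; rewrite lee_fin majorant_ge0.
- by rewrite lee_fin.
apply: le_trans (lee_wpmul2l _ (HK _ _ (de0 k))) _; first by rewrite lee_fin.
rewrite -EFinM lee_fin le_eqVlt; apply/orP; left; apply/eqP.
by field; rewrite gt_eqF.
Qed.

Lemma integral_majorant_series (N : nat -> nat) (a : nat -> nat -> R) (de : nat -> R)
    (b K B q : R) (z : nat -> R[i])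
    (H := fun j u => \sum_(N j <= k < N j.+1) a j k / de k ^+ 2 * majorant b (z k) (de k) u) :
  (forall j k, 0 <= a j k) -> (forall k, 0 < de k) -> 0 <= K -> 0 <= B -> 0 <= q < 1 ->
  (forall zeta de, 0 < de -> (\int[mu \x mu]_u (majorant b zeta de u)%:E <= (K * de ^+ 2)%:E)%E) ->
  (forall j, \sum_(N j <= k < N j.+1) a j k <= B * q ^+ j) ->
  measurable_fun setT (fun u => \sum_(j <oo) (H j u)%:E)%E /\
  (\int[mu \x mu]_u \sum_(j <oo) (H j u)%:E <= (K * B / (1 - q))%:E)%E.
Proof.
move=> a0 de0 K0 B0 q01 HK aB.
have H0 j u : 0 <= H j u.
  by apply: sumr_ge0 => k _; rewrite mulr_ge0 ?majorant_ge0// divr_ge0 ?sqr_ge0.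
have mH j : measurable_fun setT (H j).
  by apply: measurable_sum => k; apply: measurable_funM => //; exact: measurable_majorant.
split.
  apply: ge0_emeasurable_sum => [j u _ _|j _]; first by rewrite lee_fin.
  by apply/measurable_EFinP; exact: mH.
rewrite integral_nneseries//; last 2 first.
- by move=> j; apply/measurable_EFinP; exact: mH.
- by move=> j u _; rewrite lee_fin.
apply: le_trans (geom_series_le (mulr_ge0 K0 B0) q01); apply: lee_nneseries => j j0.
  by move=> *; apply: integral_ge0 => u _; rewrite lee_fin.
have IB := @integral_majorant_block (N j) (N j.+1) (a j) de b K z (a0 j) de0 HK.
by apply: le_trans IB _; rewrite lee_fin -mulrA ler_wpM2l.
Qed.

End Final.

Theorem theorem1 (R : realType) (w : R -> R) (hw : normal_function w)
    (hb : ((-1)%:E < b_index w)%E) (p : R) (hp : 1 < p)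
    (z : nat -> R[i]%C) (hz : forall n, disk (z n)) :
  interpolating_Hinfty z -> interpolating_bergman p w z.
Proof.
move=> zint c cp.
have w0 := nf_gt0 hw.
have [C [b [A [C0 b01 wC]]]] := weight_compare hw hb.
have [K K0 HK] := integral_majorant b01.
have [Q Q0 HQ] := beurling_functions hz zint.
have p0 : 0 < p by lra.
have pi0 : 0 < p^-1 by rewrite invr_gt0.
pose s := (A + 4)%N.
pose T n := normc (c n) `^ p.
have T0 n : 0 <= T n := powR_ge0 _ _.
(* with blocks of p-th power sum at most S q^j, |c_n| is at most a multiple of 4^(-j) *)
pose q : R := (4 `^ p)^-1.
have q0 : 0 < q by rewrite invr_gt0 powR_gt0.
have [N [S S0 [N0 Nlt NS]]] := summable_blocks T0 q0 cp.
have /choice[F HF] (j : nat) : exists F : nat -> R[i] -> R[i],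
  [/\ forall k, analytic_disk (F k),
      forall k l, (N j <= k < N j.+1)%N -> F k (z l) = (l == k)%:R &
      forall w, disk w -> \sum_(N j <= k < N j.+1) normc (F k w) <= Q].
  by have := HQ (N j) (N j.+1 - N j)%N; rewrite subnKC// ltnW.
pose om n := bergman_weight w p (z n).
pose de n := 1 - normc (z n).
have n0 n := normc_ge0 (z n).
have de0 n : 0 < de n by have : normc (z n) < 1 := hz n; rewrite /de; lra.
have zn01 n : 0 <= normc (z n) < 1 by rewrite n0; exact: hz.
have wz0 n : 0 < w (normc (z n)) by exact: w0.
have om0 n : 0 < om n by apply: powR_gt0; apply: mulr_gt0 => //; apply: exprn_gt0; exact: de0.
have omp n : om n `^ p = w (normc (z n)) * de n ^+ 2.
  rewrite /om /bergman_weight -powRrM mulVf ?gt_eqF// powRr1// mulr_ge0 ?sqr_ge0//; exact: ltW.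
pose al n := c n / (om n)%:C.
have nal n : normc (al n) = normc (c n) / om n.
  by rewrite normcM normcV normcR gtr0_norm.
pose g j (k : nat) (u : R[i]) := al k * (peak s (z k) u * F j k u).
pose G j u := \sum_(N j <= k < N j.+1) g j k u.
have Ga j : analytic_disk (G j).
  apply: analytic_sum => k; apply: analyticZ; apply: analyticM.
    exact: peak_analytic.
  by have [] := HF j.
(* since sum_k |F_k| <= Q, a block is controlled by its largest coefficient *)
have Gle j u (Y : R) : disk u -> 0 <= Y ->
    (forall k, (N j <= k < N j.+1)%N -> normc (c k) / om k * normc (peak s (z k) u) <= Y) ->
    normc (G j u) <= Q * Y.
  move=> du Y0 HY; apply: le_trans (normc_sum _ _ _) _.
  rewrite (eq_bigr (fun k => (normc (c k) / om k * normc (peak s (z k) u)) * normc (F j k u))).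
    apply: block_sum_le => //; first by move=> k; exact: normc_ge0.
    by have [_ _] := HF j; apply.
  by move=> k _; rewrite /g normcM nal normcM mulrA.
have blockT j k : (N j <= k < N j.+1)%N -> T k <= S * q ^+ j.
  by move=> kj; apply: le_trans (NS j); exact: le_term_sum_nat.
have blockc j k : (N j <= k < N j.+1)%N -> normc (c k) <= S `^ p^-1 / 4 ^+ j.
  move=> /blockT Tk.
  have -> : normc (c k) = T k `^ p^-1.
    by rewrite /T -powRrM divff ?gt_eqF// powRr1// normc_ge0.
  have -> : S `^ p^-1 / 4 ^+ j = (S * q ^+ j) `^ p^-1.
    rewrite powRM ?exprn_ge0 ?(ltW q0)//; congr (_ * _).
    rewrite /q exprVn -!powR_mulrn ?powR_ge0//.
    rewrite -powR_inv1 ?powR_ge0// -!powRrM -powR_inv1 ?powR_ge0// -!powRrM.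
    by congr (_ `^ _); field; rewrite gt_eqF.
  by apply: ge0_ler_powR; rewrite ?nnegrE ?(ltW pi0)// mulr_ge0// exprn_ge0// ltW.
have Gb r : r < 1 -> exists L, forall j u, normc u <= r -> normc (G j u) <= L / 2 ^+ j.
  move=> r1; have [L L0 HL] := peak_growth w0 C0 b01 hp (leqnn s) wC r1.
  exists (Q * (L * S `^ p^-1)) => j u ur.
  have du : disk u by rewrite /disk /mkset; exact: le_lt_trans r1.
  have P0 : 0 <= L * S `^ p^-1 by rewrite mulr_ge0// powR_ge0.
  have j4 : (4 ^+ j)^-1 <= (2 ^+ j)^-1 :> R.
    by rewrite lef_pV2 ?posrE ?exprn_gt0// lerXn2r ?nnegrE//; lra.
  rewrite -mulrA; apply: Gle => //.
    by rewrite divr_ge0// exprn_ge0.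
  move=> k kj.
  apply: (@le_trans _ _ (normc (c k) * L)).
    rewrite -mulrA ler_wpM2l ?normc_ge0// mulrC ler_pdivrMr//.
    exact: HL.
  rewrite mulrC -mulrA ler_wpM2l//.
  by apply: le_trans (blockc j k kj) _; rewrite ler_wpM2l ?powR_ge0.
have [f fa fs] := analytic_series Ga Gb.
exists f; last first.
  move=> l.
  (* once the blocks have passed l, the partial sums are constant *)
  have fl : f (z l) = al l.
    apply: csum_unique (fs _ (hz l)) _ => e e0; exists l.+1 => J lJ.
    have tele : \sum_(j < J) G j (z l) = \sum_(0 <= k < N J) al k * (l == k)%:R.
      elim: {lJ} J => [|J IH]; first by rewrite N0 big_ord0 big_geq.
      rewrite big_ord_recr/= IH (@big_cat_nat _ _ _ (N J) 0 (N J.+1))//=; last exact: ltnW.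
      congr (_ + _); apply: eq_big_nat => k kJ.
      rewrite /g; have [_ -> // _] := HF J.
      by case: eqP => [<-|_]; rewrite ?mulr0// peak_diag// mul1r.
    have lN : (l < N J)%N.
      apply: leq_trans lJ _; elim: J {tele} => [|J IH]//.
      exact: leq_ltn_trans IH (Nlt J).
    rewrite tele (@big_cat_nat _ _ _ l)//=; last exact: ltnW.
    rewrite (big_ltn lN) eqxx mulr1 !big_nat !big1; last 2 first.
    - by move=> k /andP[lk _]; rewrite ltn_eqF// mulr0.
    - by move=> k kl; rewrite gtn_eqF// mulr0.
    by rewrite add0r addr0 subrr normc0 ltW.
  rewrite fl /al -/(de l) -/(bergman_weight w p (z l)) -/(om l) divfK//.
  by rewrite -normc_gt0 normcR normr_gt0 gt_eqF.
split=> //.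
pose W := 2 `^ (s%:R * p) * C * 20.
have W0 : 0 < W by rewrite !mulr_gt0// powR_gt0.
(* the factor 2^(p j) is affordable because q = 4^(-p); in return every block sum
   is at most 2^(-j) times a common bound *)
pose a j k := W * (2 `^ p) ^+ j * T k.
have a0 j k : 0 <= a j k by rewrite !mulr_ge0 ?exprn_ge0 ?powR_ge0// ltW.
pose H j (u : R * R) := \sum_(N j <= k < N j.+1) a j k / de k ^+ 2 * majorant b (z k) (de k) u.
have H0t j k u : 0 <= a j k / de k ^+ 2 * majorant b (z k) (de k) u.
  by rewrite mulr_ge0 ?majorant_ge0// divr_ge0 ?sqr_ge0.
have H0 j u : 0 <= H j u by rewrite sumr_ge0.
have spA : A%:R + 4 <= s%:R * p.
  have -> : A%:R + 4 = s%:R :> R by rewrite /s natrD.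
  by rewrite ler_peMr//; exact: ltW.
have point (u : R * R) : disk (u.1 +i* u.2) ->
    ((normc (f (u.1 +i* u.2)) `^ p * w (normc (u.1 +i* u.2)))%:E <=
     ((4 * Q) `^ p)%:E * \sum_(j <oo) (H j u)%:E)%E.
  set v := u.1 +i* u.2 => dv.
  have wv : 0 < w (normc v) by apply: w0; rewrite normc_ge0.
  have Hge : (0 <= \sum_(j <oo) (H j u)%:E)%E.
    by apply: nneseries_ge0 => j _ _; rewrite lee_fin.
  have HJ j : ((H j u)%:E <= \sum_(j <oo) (H j u)%:E)%E.
    apply: le_trans (nneseries_lim_ge j.+1 _); last by move=> i _ _; rewrite lee_fin.
    by rewrite big_nat_recr//= leeDr// sume_ge0// => i _; rewrite lee_fin.
  case: (\sum_(j <oo) (H j u)%:E)%E Hge HJ => [h| |]; last by [].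
    rewrite lee_fin => h0 HJ.
    (* at a fixed point, h bounds every term of the double series, hence so does Y
       after division by the weight and extraction of the p-th root *)
    pose Y := (h / w (normc v)) `^ p^-1.
    have Y0 : 0 <= Y := powR_ge0 _ _.
    have term j k : (N j <= k < N j.+1)%N ->
        normc (c k) / om k * normc (peak s (z k) v) <= Y / 2 ^+ j.
      move=> kj; rewrite ler_pdivlMr ?exprn_gt0//.
      set X := normc (c k) / om k * _ * _.
      have X0 : 0 <= X.
        by rewrite !mulr_ge0 ?normc_ge0 ?exprn_ge0// invr_ge0 ltW.
      have -> : X = (X `^ p) `^ p^-1 by rewrite -powRrM divff ?gt_eqF// powRr1.
      apply: ge0_ler_powR; rewrite ?nnegrE ?powR_ge0 ?divr_ge0 ?(ltW pi0) ?(ltW wv)//.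
      rewrite ler_pdivlMr//.
      apply: le_trans (_ : H j u <= h); last by rewrite -lee_fin.
      apply: (@le_trans _ _ (a j k / de k ^+ 2 * majorant b (z k) (de k) u)); last first.
        exact: (@le_term_sum_nat _ _ _ _ (fun k => a j k / de k ^+ 2 * majorant b (z k) (de k) u)).
      have kw := peak_weight w0 C0 b01 p0 spA wC (hz k) dv.
      rewrite -/W -/(de k) [Re v]/= [Im v]/= -surjective_pairing in kw.
      have -> : X `^ p = T k * (2 `^ p) ^+ j / (w (normc (z k)) * de k ^+ 2) *
          normc (peak s (z k) v) `^ p.
        rewrite /X !powRM ?mulr_ge0 ?invr_ge0 ?exprn_ge0 ?normc_ge0 ?(ltW (om0 k))//.
        rewrite -(omp k) -/(T k).
        have -> : (2 ^+ j) `^ p = (2 `^ p) ^+ j :> R.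
          by rewrite -!powR_mulrn ?powR_ge0// powRAC.
        have -> : (om k)^-1 `^ p = (om k `^ p)^-1.
          by rewrite -powR_inv1 ?(ltW (om0 k))// powRAC powR_inv1 ?powR_ge0.
        by ring.
      have -> : a j k / de k ^+ 2 * majorant b (z k) (de k) u =
          T k * (2 `^ p) ^+ j / (w (normc (z k)) * de k ^+ 2) *
          (W * (w (normc (z k)) * majorant b (z k) (de k) u)).
        by rewrite /a; field; rewrite !gt_eqF.
      rewrite -[leLHS]mulrA ler_wpM2l//.
      by rewrite divr_ge0 ?mulr_ge0 ?exprn_ge0 ?powR_ge0 ?(ltW (wz0 k)) ?(ltW (de0 k)).
    have Gj j : normc (G j v) <= Q * Y / 2 ^+ j.
      rewrite -mulrA; apply: Gle => //; last exact: term.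
      by rewrite divr_ge0// exprn_ge0.
    have := csum_tail (fs v dv) Gj 0%N; rewrite big_ord0 subr0 expr0 divr1 => fv.
    have Yp : Y `^ p * w (normc v) = h.
      rewrite /Y -powRrM mulVf ?gt_eqF// powRr1 ?divfK ?gt_eqF//.
      by rewrite divr_ge0// ltW.
    rewrite -EFinM lee_fin -Yp mulrA ler_wpM2r ?(ltW wv)//.
    rewrite -powRM ?mulr_ge0//; apply: ge0_ler_powR; rewrite ?nnegrE ?normc_ge0 ?(ltW p0)//.
      by rewrite !mulr_ge0.
    by rewrite -mulrA.
  (* an infinite right-hand side: only Q = 0 needs an argument *)
  move=> _ _; have [Q1|Q1] := eqVneq Q 0; last first.
    by rewrite gt0_muley ?leey// lte_fin powR_gt0// mulr_gt0// lt_def Q1.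
  have fv : f v = 0.
    apply: csum_unique (fs v dv) _ => e e0; exists 0%N => J _.
    rewrite big1 ?subr0 ?normc0 ?ltW// => j _; apply: big1_seq => k /andP[_ kj].
    apply/eqP; rewrite -normc_eq0; have [_ _ /(_ v dv)] := HF j; rewrite Q1 => FQ.
    rewrite mem_index_iota in kj.
    have Fk : normc (F j k v) = 0.
      apply/eqP; rewrite eq_le normc_ge0 andbT; apply: le_trans FQ.
      by apply: (@le_term_sum_nat _ _ _ _ (fun i => normc (F j i v))) => // i; exact: normc_ge0.
    by rewrite /g !normcM Fk !mulr0.
  by rewrite fv normc0 powR0 ?gt_eqF// mul0r Q1 mulr0 powR0 ?gt_eqF// mul0e.
pose rr : R := 2 `^ p * q.
have rr01 : 0 <= rr < 1.
  rewrite /rr mulr_ge0 ?powR_ge0 ?(ltW q0)//= /q ltr_pdivrMr ?powR_gt0// mul1r.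
  by apply: gt0_ltr_powR; rewrite ?nnegrE//; lra.
have aB j : \sum_(N j <= k < N j.+1) a j k <= W * S * rr ^+ j.
  rewrite /a -mulr_sumr.
  have -> : W * S * rr ^+ j = W * (2 `^ p) ^+ j * (S * q ^+ j).
    by rewrite /rr exprMn; ring.
  by rewrite ler_wpM2l// mulr_ge0 ?exprn_ge0 ?powR_ge0// ltW.
have WS0 : 0 <= W * S by rewrite mulr_ge0// ltW.
have [mH IH] := integral_majorant_series z a0 de0 (ltW K0) WS0 rr01 HK aB.
apply: (@le_lt_trans _ _ (\int[lebesgue_measure \x lebesgue_measure]_u
    (((4 * Q) `^ p)%:E * \sum_(j <oo) (H j u)%:E))%E).
  apply: le_integral_nonmeas => [u du|u|u du]; last exact: point.
    by rewrite lee_fin mulr_ge0 ?powR_ge0// ltW// w0// normc_ge0.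
  by rewrite mule_ge0 ?lee_fin ?powR_ge0// nneseries_ge0// => j _ _; rewrite lee_fin.
rewrite ge0_integralZl//=; last 2 first.
- by move=> u _; apply: nneseries_ge0 => j _ _; rewrite lee_fin.
- by rewrite lee_fin powR_ge0.
apply: (@le_lt_trans _ _ (((4 * Q) `^ p)%:E * (K * (W * S) / (1 - rr))%:E)%E); last first.
  by rewrite -EFinM ltry.
by apply: lee_wpmul2l => //; rewrite lee_fin powR_ge0.
Qed.
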